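(* Let $\mathfrak g=\mathfrak{gl}(2|2)$, $\mathfrak k=\mathfrak{gl}(1|1)\oplus\mathfrak{gl}(1|1)$, and let $\lambda=(a,1^b)\in\mathscr H(1,1)$ be non-empty ($a\ge1$, $b\ge 0$) with $b=a-1$. Put $\breve\lambda=a\epsilon^+-b\,\epsilon^-+b\,\delta^+-a\,\delta^-$. If $v\in\breve W(\breve\lambda)$ is a non-zero vector of weight $(1,0|-1,0)$, then $\omega:=\xi_{11}\otimes v$ is $\mathfrak k$-quasi-spherical in the Kac module $K(\breve\lambda)$.
   Context: Ground field $\mathbb C$. $\mathfrak g=\mathfrak{gl}(2|2)$ with matrix units $E_{a,b}$, indices $1,2$ even and $3,4$ odd. $\mathfrak k$ is the span of the diagonal matrices together with $E_{13},E_{31},E_{24},E_{42}$. $\epsilon^+,\epsilon^-,\delta^+,\delta^-$ are the diagonal coordinate functions at positions $1,2,3,4$; $(x_1,x_2|x_3,x_4)$ denotes the weight $x_1\epsilon^++x_2\epsilon^-+x_3\delta^++x_4\delta^-$. $\xi_{11}=E_{31}$. $\mathfrak g=\mathfrak g_{-1}\oplus\mathfrak g_{\bar0}\oplus\mathfrak g_1$, where $\mathfrak g_1$ is spanned by the $E_{ab}$ with $a\le2<b$ and $\mathfrak g_{-1}$ by those with $b\le2<a$; $\mathfrak g_{\bar0}=\mathfrak{gl}(2)\oplus\mathfrak{gl}(2)$. $\mathscr H(1,1)$ is the set of partitions with $\lambda_2\le1$. $\breve W(\breve\lambda)$ is the irreducible $\mathfrak g_{\bar0}$-module of highest weight $\breve\lambda$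 (with respect to the upper triangular Borel subalgebra), extended to $\mathfrak g_{\bar0}\oplus\mathfrak g_1$ by letting $\mathfrak g_1$ act trivially, and $K(\breve\lambda)=\mathrm{Ind}_{\mathfrak g_{\bar0}\oplus\mathfrak g_1}^{\mathfrak g}\breve W(\breve\lambda)\cong\bigwedge(\mathfrak g_{-1})\otimes\breve W(\breve\lambda)$. Definition: if $U$ is a $\mathfrak g$-module with a unique maximal submodule $M$, a non-zero vector $w\in U$ is $\mathfrak k$-quasi-spherical if $\mathfrak k.w\subseteq M$ and $\mathfrak U(\mathfrak g).w=U$. *)

(* Defs.v *)
From HB Require Import structures.
From mathcomp Require Import all_boot all_order all_algebra.
From mathcomp Require Import boolp classical_sets reals complex monalg.

Set Implicit Arguments.
Unset Strict Implicit.
Unset Printing Implicit Defensive.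

Import GRing.Theory.
Local Open Scope ring_scope.

(* Quotients of a ring by the two-sided ideal, and of a left module by the
   submodule, generated by a set of relations.  Membership is made boolean by
   classical logic so that [Quotient.quot] applies. *)

Inductive ideal_gen (A : nzRingType) (S : A -> Prop) : A -> Prop :=
| Ideal_gen0 : ideal_gen S 0
| Ideal_genD x y : ideal_gen S x -> ideal_gen S y -> ideal_gen S (x + y)
| Ideal_genM a s b : S s -> ideal_gen S (a * s * b).

Inductive submod_gen (A : nzRingType) (V : lmodType A) (S : V -> Prop) :
  V -> Prop :=
| Submod_gen0 : submod_gen S 0
| Submod_genD x y : submod_gen S x -> submod_gen S y -> submod_gen S (x + y)
| Submod_genZ a s : S s -> submod_gen S (a *: s).

Section IdealPred.
Variables (A : nzRingType) (S : A -> Prop).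

Lemma ideal_genMl a x : ideal_gen S x -> ideal_gen S (a * x).
Proof.
elim=> [|y z _ IHy _ IHz|b s c Ss]; rewrite ?mulr0 ?mulrDr; try by constructor.
by rewrite !mulrA; constructor.
Qed.

Lemma ideal_genMr a x : ideal_gen S x -> ideal_gen S (x * a).
Proof.
elim=> [|y z _ IHy _ IHz|b s c Ss]; rewrite ?mul0r ?mulrDl; try by constructor.
by rewrite -!mulrA mulrA; constructor.
Qed.

Definition ideal_pred : {pred A} := fun x => `[< ideal_gen S x >].

Lemma ideal_predP x : reflect (ideal_gen S x) (x \in ideal_pred).
Proof. exact: asboolP. Qed.

Fact ideal_pred_zmod : zmod_closed ideal_pred.
Proof.
split=> [|x y /ideal_predP Sx /ideal_predP Sy]; apply/ideal_predP.
  exact: Ideal_gen0.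
by apply: Ideal_genD => //; rewrite -mulN1r; apply: ideal_genMl.
Qed.

HB.instance Definition _ := GRing.isZmodClosed.Build A ideal_pred ideal_pred_zmod.

End IdealPred.

Section SubmodPred.
Variables (A : nzRingType) (V : lmodType A) (S : V -> Prop).

Lemma submod_gen_scale a x : submod_gen S x -> submod_gen S (a *: x).
Proof.
elim=> [|y z _ IHy _ IHz|b s Ss]; rewrite ?scaler0 ?scalerDr; try by constructor.
by rewrite scalerA; constructor.
Qed.

Definition submod_pred : {pred V} := fun x => `[< submod_gen S x >].

Lemma submod_predP x : reflect (submod_gen S x) (x \in submod_pred).
Proof. exact: asboolP. Qed.

Fact submod_pred_zmod : zmod_closed submod_pred.
Proof.
split=> [|x y /submod_predP Sx /submod_predP Sy]; apply/submod_predP.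
  exact: Submod_gen0.
by apply: Submod_genD => //; rewrite -scaleN1r; apply: submod_gen_scale.
Qed.

HB.instance Definition _ :=
  GRing.isZmodClosed.Build V submod_pred submod_pred_zmod.

Definition quot_mod := {ideal_quot submod_pred}.
HB.instance Definition _ := GRing.Zmodule.on quot_mod.

Local Open Scope quotient_scope.

Definition quot_proj (x : V) : quot_mod := \pi_({ideal_quot submod_pred}) x.

Lemma quot_projP x y : (quot_proj x = quot_proj y) <-> submod_gen S (x - y).
Proof.
split=> [/eqP|Sxy]; last apply/eqP; last first.
  by rewrite /quot_proj -Quotient.idealrBE; apply/submod_predP.
by rewrite /quot_proj -Quotient.idealrBE => /submod_predP.
Qed.

Lemma quot_projK (x : quot_mod) : quot_proj (repr x) = x.
Proof. exact: (@reprK _ {ideal_quot submod_pred}). Qed.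

Lemma quot_projD x y : quot_proj (x + y) = quot_proj x + quot_proj y.
Proof. exact: (@raddfD _ _ \pi_({ideal_quot submod_pred})). Qed.

Definition quot_scale (a : A) (x : quot_mod) : quot_mod :=
  quot_proj (a *: (repr x : V)).

Lemma quot_scale_pi a x : quot_scale a (quot_proj x) = quot_proj (a *: x).
Proof.
apply/quot_projP; rewrite -scalerBr; apply: submod_gen_scale.
by apply/quot_projP; rewrite quot_projK.
Qed.

Fact quot_scaleA a b x : quot_scale a (quot_scale b x) = quot_scale (a * b) x.
Proof. by rewrite -[x]quot_projK !quot_scale_pi scalerA. Qed.

Fact quot_scale1 : left_id 1 quot_scale.
Proof. by move=> x; rewrite -[x]quot_projK quot_scale_pi scale1r. Qed.

Fact quot_scaleDr : right_distributive quot_scale +%R.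
Proof.
move=> a x y; rewrite -[x]quot_projK -[y]quot_projK.
by rewrite -quot_projD !quot_scale_pi -quot_projD scalerDr.
Qed.

Fact quot_scaleDl x : {morph quot_scale^~ x : a b / a + b}.
Proof.
by move=> a b; rewrite -[x]quot_projK !quot_scale_pi scalerDl quot_projD.
Qed.

HB.instance Definition _ := GRing.Zmodule_isLmodule.Build A quot_mod
  quot_scaleA quot_scale1 quot_scaleDr quot_scaleDl.

End SubmodPred.

(* The Lie superalgebra gl(2|2) on 'M[F]_4.  The positions 1, 2 | 3, 4 of the
   informal indexing are the ordinals 0, 1 | 2, 3, so that [inord 2] and
   [inord 0] below index E_31. *)

Definition idx := ('I_4 * 'I_4)%type.

Definition par (i : 'I_4) : bool := (2 <= i)%N.

Section GL22.
Variable F : fieldType.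
Notation gl := 'M[F]_4.

Definition span_units (P : rel 'I_4) : {vspace gl} :=
  <<[seq delta_mx i j | i <- enum 'I_4, j <- [seq j <- enum 'I_4 | P i j]]>>%VS.

Definition homog (d : bool) := span_units (fun i j => par i (+) par j == d).
Definition g0 := homog false.
Definition g1 := span_units (fun i j => ~~ par i && par j).
(* Strictly upper triangular part of g0, i.e. the span of E_12 and E_34. *)
Definition n0 := span_units (fun i j => (i < j)%N && (par i == par j)).
(* The off-diagonal positions of k are 13, 31, 24 and 42. *)
Definition kk := span_units
  (fun i j => [|| i == j, (j == i + 2 :> nat)%N | (i == j + 2 :> nat)%N]).

Definition xi11 : gl := delta_mx (inord 2) (inord 0).

(* [x, y] for x of parity d and y of parity e. *)
Definition sbracket (d e : bool) (x y : gl) : gl :=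
  x *m y - (-1) ^+ (d && e) *: (y *m x).

(* U(g) is the tensor algebra T(g), realised as the free associative algebra
   on the basis E_ij of g, modulo the usual relations. *)

Notation Tg := {malg F[{fmonom idx}]}.

Definition tens_elt (x : gl) : Tg := \sum_i \sum_j << x i j *g fmu (i, j) >>.

Inductive Ug_rel : Tg -> Prop :=
  UgRel d e x y of x \in homog d & y \in homog e :
    Ug_rel (tens_elt x * tens_elt y
            - (-1) ^+ (d && e) *: (tens_elt y * tens_elt x)
            - tens_elt (sbracket d e x y)).

Definition Ug := {ideal_quot (ideal_pred Ug_rel)}.
HB.instance Definition _ := GRing.Zmodule.on Ug.

Local Open Scope quotient_scope.

Definition Ug_proj (x : Tg) : Ug := \pi_({ideal_quot (ideal_pred Ug_rel)}) x.

Lemma Ug_projP x y : (Ug_proj x = Ug_proj y) <-> ideal_gen Ug_rel (x - y).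
Proof.
split=> [/eqP|Sxy]; last apply/eqP; last first.
  by rewrite /Ug_proj -Quotient.idealrBE; apply/ideal_predP.
by rewrite /Ug_proj -Quotient.idealrBE => /ideal_predP.
Qed.

Lemma Ug_projK (x : Ug) : Ug_proj (repr x) = x.
Proof. exact: (@reprK _ {ideal_quot (ideal_pred Ug_rel)}). Qed.

Lemma Ug_projD x y : Ug_proj (x + y) = Ug_proj x + Ug_proj y.
Proof. exact: (@raddfD _ _ \pi_({ideal_quot (ideal_pred Ug_rel)})). Qed.

Definition Ug_mul (x y : Ug) : Ug := Ug_proj ((repr x : Tg) * (repr y : Tg)).

Lemma Ug_mul_pi x y : Ug_mul (Ug_proj x) (Ug_proj y) = Ug_proj (x * y).
Proof.
apply/Ug_projP; set x' : Tg := repr _; set y' : Tg := repr _.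
have -> : x' * y' - x * y = (x' - x) * y' + x * (y' - y).
  by rewrite mulrBl mulrBr addrA subrK.
apply: Ideal_genD; [apply: ideal_genMr | apply: ideal_genMl].
  by apply/Ug_projP; rewrite Ug_projK.
by apply/Ug_projP; rewrite Ug_projK.
Qed.

Fact Ug_mulA : associative Ug_mul.
Proof.
move=> x y z; rewrite -[x]Ug_projK -[y]Ug_projK -[z]Ug_projK.
by rewrite !Ug_mul_pi mulrA.
Qed.

Fact Ug_mul1 : left_id (Ug_proj 1) Ug_mul.
Proof. by move=> x; rewrite -[x]Ug_projK Ug_mul_pi mul1r. Qed.

Fact Ug_mulr1 : right_id (Ug_proj 1) Ug_mul.
Proof. by move=> x; rewrite -[x]Ug_projK Ug_mul_pi mulr1. Qed.

Fact Ug_mulDl : left_distributive Ug_mul +%R.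
Proof.
move=> x y z; rewrite -[x]Ug_projK -[y]Ug_projK -[z]Ug_projK.
by rewrite -Ug_projD !Ug_mul_pi mulrDl Ug_projD.
Qed.

Fact Ug_mulDr : right_distributive Ug_mul +%R.
Proof.
move=> x y z; rewrite -[x]Ug_projK -[y]Ug_projK -[z]Ug_projK.
by rewrite -Ug_projD !Ug_mul_pi mulrDr Ug_projD.
Qed.

(* The relations lie in the augmentation ideal, so U(g) is not trivial. *)
Lemma tens_elt_aug x : (tens_elt x)@_mone = 0.
Proof.
rewrite raddf_sum big1 // => i _; rewrite raddf_sum big1 // => j _.
by rewrite /= mcoeffU fm1_eq1.
Qed.

Fact augM (x y : Tg) : (x * y)@_mone = x@_mone * y@_mone.
Proof. by case: (@mcoeff1g_is_multiplicative {fmonom idx} F) => ->. Qed.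

Lemma ideal_gen_aug x : ideal_gen Ug_rel x -> x@_mone = 0.
Proof.
elim=> [|y z _ IHy _ IHz|a s b [d e y z _ _]]; first exact: mcoeff0.
  by rewrite mcoeffD IHy IHz addr0.
rewrite 2!augM.
move: (tens_elt_aug y) (tens_elt_aug z) (tens_elt_aug (sbracket d e y z)).
move: (tens_elt y) (tens_elt z) (tens_elt _) => p q r p0 q0 r0.
by rewrite mcoeffB r0 subr0 mcoeffB mcoeffZ !augM p0 q0 !mulr0 subr0 mulr0 mul0r.
Qed.

Fact Ug_one_neq0 : Ug_proj 1 != 0.
Proof.
apply/eqP; rewrite -[0]Ug_projK => /Ug_projP H.
have /Ug_projP : Ug_proj (repr (0 : Ug)) = Ug_proj 0.
  by rewrite Ug_projK; apply/esym; exact: (@raddf0 _ _ \pi_({ideal_quot _})).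
move=> /(Ideal_genD H); rewrite subr0 subrK => /ideal_gen_aug/eqP.
by rewrite rmorph1 oner_eq0.
Qed.

HB.instance Definition _ := GRing.Zmodule_isNzRing.Build Ug
  Ug_mulA Ug_mul1 Ug_mulr1 Ug_mulDl Ug_mulDr Ug_one_neq0.

Definition Ug_scale (c : F) (u : Ug) : Ug := Ug_proj c%:MP * u.

Fact Ug_projM x y : Ug_proj (x * y) = Ug_proj x * Ug_proj y.
Proof. by rewrite -Ug_mul_pi. Qed.

Fact Ug_scaleA c d u : Ug_scale c (Ug_scale d u) = Ug_scale (c * d) u.
Proof. by rewrite /Ug_scale mulrA -Ug_projM -rmorphM. Qed.

Fact Ug_scale1 : left_id 1 Ug_scale.
Proof. by move=> u; rewrite /Ug_scale rmorph1 mul1r. Qed.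

Fact Ug_scaleDr : right_distributive Ug_scale +%R.
Proof. by move=> c u v; rewrite /Ug_scale mulrDr. Qed.

Fact Ug_scaleDl u : {morph Ug_scale^~ u : c d / c + d}.
Proof. by move=> c d; rewrite /Ug_scale rmorphD Ug_projD mulrDl. Qed.

HB.instance Definition _ := GRing.Zmodule_isLmodule.Build F Ug
  Ug_scaleA Ug_scale1 Ug_scaleDr Ug_scaleDl.

Fact Ug_scaleAl c (u v : Ug) : c *: (u * v) = c *: u * v.
Proof. exact: mulrA. Qed.

HB.instance Definition _ := GRing.Lmodule_isLalgebra.Build F Ug Ug_scaleAl.

(* The canonical map g -> U(g); a g-module is a left Ug-module, on which
   x \in g acts by [Ug_of x *: _].  No Z/2-grading is recorded: in the modules
   considered the parity of a weight vector is a function of its weight, so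
   submodules are automatically graded. *)
Definition Ug_of (x : gl) : Ug := Ug_proj (tens_elt x).

(* Modules over the subalgebra S of g: [act x] is only meaningful for x in S. *)

Section Representations.
Variables (W : lmodType F) (act : gl -> W -> W).

Definition is_rep (S : {vspace gl}) : Prop :=
  [/\ forall x, x \in S -> forall c w w',
        act x (c *: w + w') = c *: act x w + act x w',
      forall x y, x \in S -> y \in S -> forall c w,
        act (c *: x + y) w = c *: act x w + act y w
    & forall d e x y, x \in S -> y \in S -> x \in homog d -> y \in homog e ->
      forall w, act (sbracket d e x y) w
                = act x (act y w) - (-1) ^+ (d && e) *: act y (act x w)].

Definition stable (S : {vspace gl}) (M : set W) : Prop :=
  [/\ M 0,
      forall c w w', M w -> M w' -> M (c *: w + w')
    & forall x w, x \in S -> M w -> M (act x w)].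

Definition irreducible (S : {vspace gl}) : Prop :=
  (exists w : W, w != 0)
  /\ forall M : set W, stable S M -> M = [set 0]%classic \/ M = setT.

(* x1 eps+ + x2 eps- + x3 delta+ + x4 delta-, by its coordinates. *)
Definition wt (x1 x2 x3 x4 : F) : 'rV[F]_4 :=
  \row_i nth 0 [:: x1; x2; x3; x4] i.

Definition has_weight (mu : 'rV[F]_4) (w : W) : Prop :=
  forall h : 'rV[F]_4, act (diag_mx h) w = (\sum_i mu 0 i * h 0 i) *: w.

Definition has_highest_weight (mu : 'rV[F]_4) : Prop :=
  exists w : W,
    [/\ w != 0, has_weight mu w & forall x, x \in n0 -> act x w = 0].

End Representations.

Section Induction.
Variables (W : lmodType F) (p : {vspace gl}) (act : gl -> W -> W).

(* U(g) (x)_{U(p)} W is the free left U(g)-module on the set W modulo these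
   relations; u (x) w is the class of u times the generator <<w>>, so that
   additivity in u holds already in the free module.  As U(p) is generated by
   scalars and p, the last two relations make the product U(p)-balanced. *)
Inductive ind_rel : {malg Ug[W]} -> Prop :=
| IndRelD w w' : ind_rel (<< w + w' >> - << w >> - << w' >>)
| IndRelZ c w : ind_rel (<< c%:A *g w >> - << c *: w >>)
| IndRelA x w of x \in p : ind_rel (<< Ug_of x *g w >> - << act x w >>).

Definition Ind := quot_mod ind_rel.
HB.instance Definition _ := GRing.Lmodule.on Ind.

Definition tens (u : Ug) (w : W) : Ind := quot_proj ind_rel << u *g w >>.

End Induction.

Definition even_part (x : gl) : gl :=
  \matrix_(i, j) (if par i == par j then x i j else 0).

(* Inflation of a g0-module to g0 + g1, with g1 acting by 0. *)
Definition infl (W : lmodType F) (act : gl -> W -> W) (x : gl) : W -> W :=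
  act (even_part x).

Definition Kac (W : lmodType F) (act : gl -> W -> W) : lmodType Ug :=
  Ind (g0 + g1)%VS (infl act).

Definition kac_tens (W : lmodType F) (act : gl -> W -> W) (u : Ug) (w : W) :
  Kac act := tens (g0 + g1)%VS (infl act) u w.

Section QuasiSpherical.
Variable V : lmodType Ug.

Definition is_submod (M : set V) : Prop :=
  M 0 /\ forall (a : Ug) u v, M u -> M v -> M (a *: u + v).

Definition maximal_submod (M : set V) : Prop :=
  [/\ is_submod M, M <> setT
    & forall N, is_submod N -> (M `<=` N)%classic -> N = M \/ N = setT].

(* Existence and uniqueness of the maximal submodule are part of the claim. *)
Definition quasi_spherical (k : {vspace gl}) (w : V) : Prop :=
  exists M : set V,
    [/\ maximal_submod M /\ (forall N, maximal_submod N -> N = M),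
        w != 0,
        forall x, x \in k -> M (Ug_of x *: w)
      & forall u : V, exists a : Ug, u = a *: w].

End QuasiSpherical.

End GL22.

(* Partitions with lambda_2 <= 1. *)
Definition H11 (lam : seq nat) : bool :=
  [&& sorted geq lam, 0%N \notin lam & (nth 0%N lam 1 <= 1)%N].

(* Main.v *)
Require Import Defs.
From HB Require Import structures.
From mathcomp Require Import all_boot all_order all_algebra.
From mathcomp Require Import boolp classical_sets reals complex finmap monalg.
From mathcomp Require Import ring.

Set Implicit Arguments.
Unset Strict Implicit.
Unset Printing Implicit Defensive.

Import GRing.Theory Num.Theory.
Local Open Scope ring_scope.

(** Write K for the Kac module, W for its top and E_ab for matrix units with
    indices from 1 to 4.  The element z = E_11 + E_22 commutes with g_0, has
    [z, x] = -x for x in g_-1, and acts on W by a scalar c; hence it acts by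
    c - n on the piece of K spanned by products of n elements of g_-1 applied to W.
    Polynomials in z separate these pieces, so a submodule with a vector whose
    component in W is w <> 0 contains w itself, and then, W being irreducible,
    is all of K.  The remaining submodules lie in the sum K' of the pieces
    n >= 1, and M = {u | U(g) u is contained in K'} is the unique maximal
    submodule ([submod_rad_or_full]).

    Put omega = E_31 (x) v.  Since E_23 omega = E_21 v lies in W, omega generates
    K as soon as E_21 v <> 0.  The diagonal matrices, E_13, E_24 and E_31 kill
    omega: the weight of v was chosen so that omega has weight zero.  Thus
    k omega is spanned by E_42 omega, of degree 2.  A vector of degree n killed
    by all products of n elements of g_1 is in M ([singular_rad], a form of the
    triangular decomposition of U(g)), and the only product of two elements of
    g_1 that does not kill E_42 omega for formal reasons gives

      E_14 E_23 E_42 E_31 v = E_43 E_34 v - E_12 E_21 v.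

    The quadratic Casimir elements of the two copies of gl(2) act on W by the
    scalar read off at the highest weight; comparing with the weight of v, and
    using b = a - 1, one finds E_12 E_21 v = a^2 v = E_43 E_34 v
    ([raise_lower_even], [lower_raise_odd]).  So the difference vanishes, and
    E_21 v <> 0 because a <> 0.

    All this would be void if W mapped to zero in K, which is presented by
    generators and relations.  That W embeds is the substance of the
    Poincare-Birkhoff-Witt theorem here; it follows from an explicit action of g
    on the exterior algebra of g_-1 tensored with W ([fock_op_bracket]) and from
    the universal property of the induced module ([tens1_eq0]). *)

(** * Spans of matrix units *)

Section SpanUnits.
Variable F : fieldType.

Lemma span_unitsP (P : rel 'I_4) (x : 'M[F]_4) :
  reflect (forall i j, ~~ P i j -> x i j = 0) (x \in span_units F P).
Proof.
apply: (iffP idP) => [x_in i j nPij|x0].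
  pose s := [seq (delta_mx i j : 'M[F]_4) |
    i <- enum 'I_4, j <- [seq j <- enum 'I_4 | P i j]].
  have sE : x \in <<in_tuple s>>%VS by [].
  rewrite (coord_span sE) summxE big1 // => k _; rewrite mxE.
  have /allpairsPdep[i' [j' [_]]] : s`_k \in s by exact: mem_nth.
  rewrite mem_filter => /andP[Pij' _] ->; rewrite mxE.
  case: eqP => [ii'|]; last by rewrite mulr0.
  case: eqP => [jj'|]; last by rewrite mulr0.
  by rewrite ii' jj' Pij' in nPij.
rewrite (matrix_sum_delta x); apply: memv_suml => i _; apply: memv_suml => j _.
case Pij: (P i j); last by rewrite x0 ?Pij // scale0r mem0v.
apply/memvZ/memv_span/allpairsPdep; exists i, j.
by split=> //; [rewrite mem_enum | rewrite mem_filter Pij /= mem_enum].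
Qed.

Lemma delta_span_units (P : rel 'I_4) i j :
  P i j -> (delta_mx i j : 'M[F]_4) \in span_units F P.
Proof.
move=> Pij; apply/span_unitsP => k l; rewrite mxE.
by case: eqP => [->|//]; case: eqP => [->|//]; rewrite Pij.
Qed.

Lemma span_units_mulmx (P Q T : rel 'I_4) (x y : 'M[F]_4) :
    (forall i k j, P i k -> Q k j -> T i j) ->
  x \in span_units F P -> y \in span_units F Q -> x *m y \in span_units F T.
Proof.
move=> PQT /span_unitsP x0 /span_unitsP y0; apply/span_unitsP => i j Tij.
rewrite mxE big1 // => k _.
have [Pik|/x0->] := boolP (P i k); last by rewrite mul0r.
have [Qkj|/y0->] := boolP (Q k j); last by rewrite mulr0.
by rewrite (PQT _ _ _ Pik Qkj) in Tij.
Qed.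

Lemma span_units_homog (P : rel 'I_4) d (x : 'M[F]_4) :
  (forall i j, P i j -> par i (+) par j = d) ->
  x \in span_units F P -> x \in homog F d.
Proof.
move=> Pd /span_unitsP x0; apply/span_unitsP => i j ij; apply: x0.
by apply: contraNN ij => /Pd /= ->; rewrite eqxx.
Qed.

Lemma diag_delta n (i : 'I_n) : diag_mx (delta_mx 0 i) = delta_mx i i :> 'M[F]_n.
Proof.
apply/matrixP => k l; rewrite !mxE eqxx /=.
by case: (k =P i) => [->|_]; rewrite ?mul0rn // [i == l]eq_sym; case: (l == i).
Qed.

End SpanUnits.

(** * The action of gl(2|2) on the exterior algebra of g_-1 tensored with W *)

(** Basis monomials of the exterior algebra on E_31, E_32, E_41, E_42, in this
    order: a state records which of the four factors are present. *)
Definition fock_state := (bool * bool * bool * bool)%type.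
Definition occupation (s : fock_state) : seq bool :=
  let: (x0, x1, x2, x3) := s in [:: x0; x1; x2; x3].
Definition occupied (k : nat) (s : fock_state) := nth false (occupation s) k.
Definition toggle (k : nat) (s : fock_state) : fock_state :=
  let: (x0, x1, x2, x3) := s in
  (x0 (+) (k == 0%N), x1 (+) (k == 1%N), x2 (+) (k == 2%N), x3 (+) (k == 3%N)).
(** Sign of moving the k-th generator past the ones that precede it. *)
Definition fock_sign (k : nat) (s : fock_state) : bool :=
  odd (count id (take k (occupation s))).

(** Operators on the tensor product are described on basis states with formal
    coefficients, so that identities between them can be decided by computation
    uniformly in W.  A word lists units E_ab of g_0, numbered from 0, which act
    on W with the last one first; a term is a sign ([true] for minus), a word and
    a resulting state. *)
Definition word := seq (nat * nat).
Definition formal_vec := seq (bool * (word * fock_state)).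
Definition kernel := fock_state -> formal_vec.

Definition kcreate k : kernel := fun s =>
  if occupied k s then [::] else [:: (fock_sign k s, ([::], toggle k s))].
Definition kannih k : kernel := fun s =>
  if occupied k s then [:: (fock_sign k s, ([::], toggle k s))] else [::].
(** A unit of g_0 acting on the factor W alone. *)
Definition kunit p : kernel := fun s => [:: (false, ([:: p], s))].
Definition kadd (f g : kernel) : kernel := fun s => f s ++ g s.
Definition ksign (c : bool) (f : kernel) : kernel := fun s =>
  [seq (c (+) x.1, x.2) | x <- f s].
Definition kcomp (f g : kernel) : kernel := fun s =>
  flatten [seq [seq (x.1 (+) y.1, (y.2.1 ++ x.2.1, y.2.2)) | y <- f x.2.2] | x <- g s].

(** The place of E_ji, j odd and i even, in the chosen order of generators. *)
Definition xi_pos (j i : nat) : nat := (2 * (j - 2) + i)%N.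

(** Writing xi_ji for multiplication by E_ji and d_ji for the derivation dual to
    it, the units of g act as follows (i, k even; j, l odd; e acts on W):
    - E_ji is xi_ji;
    - E_ik is e_ik - sum_j xi_jk d_ji and E_jl is e_jl + sum_i xi_ji d_li, which
      combine the action on W with the adjoint action on g_-1;
    - E_ij is sum_k e_ik d_jk + sum_l E_lj d_li, the result of moving E_ij to the
      right through a monomial, where it kills W. *)
Definition gl_kernel (a b : nat) : kernel :=
  match (a < 2)%N, (b < 2)%N with
  | false, true => kcreate (xi_pos a b)
  | true, true =>
    kadd (kunit (a, b))
      (ksign true (kadd (kcomp (kcreate (xi_pos 2 b)) (kannih (xi_pos 2 a)))
                         (kcomp (kcreate (xi_pos 3 b)) (kannih (xi_pos 3 a)))))
  | false, false =>
    kadd (kunit (a, b))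
      (kadd (kcomp (kcreate (xi_pos a 0)) (kannih (xi_pos b 0)))
            (kcomp (kcreate (xi_pos a 1)) (kannih (xi_pos b 1))))
  | true, false =>
    let t l := kadd (kunit (l, b))
      (kadd (kcomp (kcreate (xi_pos l 0)) (kannih (xi_pos b 0)))
            (kcomp (kcreate (xi_pos l 1)) (kannih (xi_pos b 1)))) in
    kadd (kadd (kcomp (kunit (a, 0)) (kannih (xi_pos b 0)))
               (kcomp (kunit (a, 1)) (kannih (xi_pos b 1))))
         (kadd (kcomp (t 2) (kannih (xi_pos 2 a)))
               (kcomp (t 3) (kannih (xi_pos 3 a))))
  end%N.

Definition nat_par (i : nat) : bool := (2 <= i)%N.
Definition unit_par (p : nat * nat) : bool := nat_par p.1 (+) nat_par p.2.
Definition even_unit (p : nat * nat) : bool :=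
  [&& p.1 < 4, p.2 < 4 & ~~ unit_par p]%N.

Definition kwhen (c : bool) (f : kernel) : kernel := fun s => if c then f s else [::].

(** The defect in the bracket relation for the units p and q. *)
Definition kernel_bracket (p q : nat * nat) : kernel :=
  let sg := unit_par p && unit_par q in
  kadd (kadd (kcomp (gl_kernel p.1 p.2) (gl_kernel q.1 q.2))
             (ksign (~~ sg) (kcomp (gl_kernel q.1 q.2) (gl_kernel p.1 p.2))))
       (kadd (kwhen (p.2 == q.1) (ksign true (gl_kernel p.1 q.2)))
             (kwhen (q.2 == p.1) (ksign sg (gl_kernel q.1 p.2)))).

(** One commutation in g_0 brings a word of length two into increasing order, and
    longer words do not occur in a product of two operators. *)
Definition straighten (u : word) : seq (bool * word) :=
  match u with
  | [:: p; q] => if [&& even_unit p, even_unit q & (4 * q.1 + q.2 < 4 * p.1 + p.2)%N] then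
     (false, [:: q; p]) :: (if p.2 == q.1 then [:: (false, [:: (p.1, q.2)])] else [::]) ++
        (if q.2 == p.1 then [:: (true, [:: (q.1, p.2)])] else [::])
     else [:: (false, u)]
  | _ => [:: (false, u)]
  end.

Definition straighten_vec (L : formal_vec) : formal_vec :=
  flatten [seq [seq (x.1 (+) y.1, (y.2, x.2.2)) | y <- straighten x.2.1] | x <- L].

(** Every term occurs as often with sign plus as with sign minus. *)
Definition cancelling (L : formal_vec) : bool :=
  all (fun x => count_mem (true, x.2) L == count_mem (false, x.2) L) L.

Definition fock_states : seq fock_state :=
  let B := [:: false; true] in
  [seq (u, x3) | u <- [seq (u, x2) | u <- [seq (x0, x1) | x0 <- B, x1 <- B],
     x2 <- B], x3 <- B].

Definition gl_units := [seq (i, j) | i <- iota 0 4, j <- iota 0 4].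

(** The bracket relations of gl(2|2), 256 pairs on 16 states each, hold after
    straightening by mere cancellation. *)
Lemma kernel_bracket_check :
  all (fun p => all (fun q => all
    (fun s => cancelling (straighten_vec (kernel_bracket p q s))) fock_states) gl_units)
    gl_units.
Proof. by vm_compute. Qed.

Lemma mem_fock_states s : s \in fock_states.
Proof. by case: s => [[[[] []] []] []]. Qed.

Lemma big_signed_count (T : eqType) (F : pzRingType) (M : lmodType F)
    (phi : T -> M) (U : seq T) (L : seq (bool * T)) : uniq U -> {subset unzip2 L <= U} ->
  \sum_(x <- L) (-1) ^+ x.1 *: phi x.2
  = \sum_(k <- U) (phi k *+ count_mem (false, k) L - phi k *+ count_mem (true, k) L).
Proof.
move=> uniqU; elim: L => [|[b k] L IHL] sLU.
  by rewrite big_nil big1 // => k _; rewrite subrr.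
rewrite big_cons IHL => [|t tL]; last by rewrite sLU // inE tL orbT.
have kU : k \in U by rewrite sLU ?inE ?eqxx.
rewrite !(bigD1_seq k) //= addrA; congr (_ + _); last first.
  apply: eq_bigr => t /negPf tk; rewrite !xpair_eqE [k == t]eq_sym tk.
  by rewrite !andbF.
rewrite !xpair_eqE eqxx !andbT; case: b {sLU} => /=.
  by rewrite !add0n add1n mulrS opprD expr1 scaleN1r addrCA.
by rewrite !add0n add1n mulrS expr0 scale1r addrA.
Qed.

Section FockModule.
Variables (F : fieldType) (W : lmodType F) (act : 'M[F]_4 -> W -> W).
Hypothesis hrep : is_rep act (g0 F).
Notation V := {ffun fock_state -> W}.

Definition gl_unit (p : nat * nat) : 'M[F]_4 := delta_mx (inord p.1) (inord p.2).

(** Zero on odd units, where [act] need not even be additive. *)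
Definition unit_act (p : nat * nat) (w : W) : W :=
  if even_unit p then act (gl_unit p) w else 0.

Lemma even_unit_g0 p : even_unit p -> gl_unit p \in g0 F.
Proof.
case: p => i j /and3P[/= i4 j4 ij]; apply: delta_span_units.
by rewrite /par !inordK //; move: ij; rewrite /unit_par /nat_par /=; case: (_ (+) _).
Qed.

Lemma gl_unit_mul p q : even_unit p -> even_unit q ->
  [/\ gl_unit p *m gl_unit q = gl_unit (p.1, q.2) *+ (p.2 == q.1)
    & p.2 = q.1 -> even_unit (p.1, q.2)].
Proof.
case: p q => [i j] [k l] /and3P[/= i4 j4 ij] /and3P[/= k4 l4 kl].
split=> [|jk]; first by rewrite mul_delta_mx_cond -val_eqE /= !inordK.
rewrite /even_unit /= i4 l4 /=.
by move: ij kl; rewrite jk /unit_par /nat_par /=; do 3!case: (1 < _)%N.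
Qed.

Lemma unit_act_lin p c w w' :
  unit_act p (c *: w + w') = c *: unit_act p w + unit_act p w'.
Proof.
rewrite /unit_act; case: ifP => [/even_unit_g0 pE|_].
  by case: hrep => act_lin _ _; apply: act_lin.
by rewrite scaler0 addr0.
Qed.

Lemma act_units x w : x \in g0 F ->
  act x w = \sum_i \sum_j x i j *: unit_act (val i, val j) w.
Proof.
move=> /span_unitsP x0; case: hrep => _ act_linl _.
pose K (y : 'M[F]_4) u := y \in g0 F /\ act y w = u.
suff: K (\sum_i \sum_j x i j *: delta_mx i j)
        (\sum_i \sum_j x i j *: unit_act (val i, val j) w).
  by rewrite -matrix_sum_delta => -[].
have K0 : K 0 0.
  split; first exact: mem0v.
  have := act_linl 0 0 (mem0v _) (mem0v _) (-1) w.
  by rewrite scaler0 addr0 scaleN1r addNr.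
have KD y u y' u' : K y u -> K y' u' -> K (y + y') (u + u').
  move=> [yg <-] [yg' <-]; split; first exact: memvD.
  by rewrite -[y]scale1r act_linl // !scale1r.
apply: (big_ind2 K K0 KD) => i _; apply: (big_ind2 K K0 KD) => j _.
have [ij|ij] := boolP (par i (+) par j == false); last first.
  by rewrite x0 // !scale0r.
have ijE : even_unit (val i, val j).
  rewrite /even_unit /= !ltn_ord /=; move: ij.
  by rewrite /unit_par /par /nat_par /=; case: (_ (+) _).
have eg : (delta_mx i j : 'M[F]_4) \in g0 F by exact: delta_span_units.
split; first exact: memvZ.
rewrite /unit_act ijE -[x i j *: delta_mx i j]addr0 act_linl ?mem0v //.
by case: K0 => _ ->; rewrite addr0 /gl_unit !inord_val.
Qed.

(** This justifies [straighten]. *)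
Lemma unit_act_bracket p q w : even_unit p -> even_unit q ->
  unit_act p (unit_act q w) = unit_act q (unit_act p w)
    + (if p.2 == q.1 then unit_act (p.1, q.2) w else 0)
    - (if q.2 == p.1 then unit_act (q.1, p.2) w else 0).
Proof.
case: hrep => _ act_linl act_br pE qE.
have pg := even_unit_g0 pE; have qg := even_unit_g0 qE.
have act0l : act 0 w = 0.
  by have := act_linl _ _ pg pg (-1) w; rewrite scaleN1r scaleN1r !addNr.
have act_mul r t : even_unit r -> even_unit t ->
    gl_unit r *m gl_unit t \in g0 F
    /\ act (gl_unit r *m gl_unit t) w
       = if r.2 == t.1 then unit_act (r.1, t.2) w else 0.
  move=> rE tE; have [-> rtE] := gl_unit_mul rE tE.
  case: eqP => [/rtE eE|_]; last by rewrite mulr0n mem0v.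
  by rewrite mulr1n /unit_act eE even_unit_g0.
have actB x y : x \in g0 F -> y \in g0 F -> act (x - y) w = act x w - act y w.
  by move=> xg yg; rewrite [x - y]addrC -[- y]scaleN1r act_linl // scaleN1r addrC.
have [pqg <-] := act_mul p q pE qE; have [qpg <-] := act_mul q p qE pE.
have := act_br false false _ _ pg qg pg qg w.
rewrite /sbracket expr0 !scale1r actB // /unit_act pE qE -addrA => ->.
by rewrite addrC subrK.
Qed.

Definition word_act (u : word) (w : W) : W := foldr unit_act w u.

Lemma word_act_lin u c w w' :
  word_act u (c *: w + w') = c *: word_act u w + word_act u w'.
Proof. by rewrite /word_act; elim: u => //= p u ->; rewrite unit_act_lin. Qed.

(** The vector s (x) w. *)
Definition state_vec (s : fock_state) (w : W) : V :=
  [ffun t => if t == s then w else 0].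

Lemma state_vec_lin s c w w' :
  state_vec s (c *: w + w') = c *: state_vec s w + state_vec s w'.
Proof.
by apply/ffunP => t; rewrite !ffunE; case: eqP => // _; rewrite scaler0 addr0.
Qed.

Lemma state_vec0 s : state_vec s 0 = 0.
Proof. by apply/ffunP => t; rewrite !ffunE if_same. Qed.

Lemma state_vecD s w w' : state_vec s (w + w') = state_vec s w + state_vec s w'.
Proof. by rewrite -[w]scale1r state_vec_lin !scale1r. Qed.

Lemma state_vecB s w w' : state_vec s (w - w') = state_vec s w - state_vec s w'.
Proof. by rewrite addrC -scaleN1r state_vec_lin scaleN1r addrC. Qed.

Definition eval_vec (L : formal_vec) (w : W) : V :=
  \sum_(x <- L) (-1) ^+ x.1 *: state_vec x.2.2 (word_act x.2.1 w).

Lemma eval_vec_lin L c w w' :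
  eval_vec L (c *: w + w') = c *: eval_vec L w + eval_vec L w'.
Proof.
rewrite /eval_vec scaler_sumr -big_split; apply: eq_bigr => x _ /=.
by rewrite word_act_lin state_vec_lin scalerDr !scalerA mulrC.
Qed.

Lemma eval_vec0 L : eval_vec L 0 = 0.
Proof. by rewrite -[0 in LHS](addNr 0) -scaleN1r eval_vec_lin scaleN1r addNr. Qed.

Lemma eval_vec_cat L L' w : eval_vec (L ++ L') w = eval_vec L w + eval_vec L' w.
Proof. exact: big_cat. Qed.

Definition kernel_op (k : kernel) (v : V) : V := \sum_s eval_vec (k s) (v s).

Lemma kernel_op_lin k c v v' :
  kernel_op k (c *: v + v') = c *: kernel_op k v + kernel_op k v'.
Proof.
rewrite /kernel_op scaler_sumr -big_split; apply: eq_bigr => s _ /=.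
by rewrite !ffunE eval_vec_lin.
Qed.

Lemma kernel_op0 k : kernel_op k 0 = 0.
Proof. by rewrite -[0 in LHS](addNr 0) -scaleN1r kernel_op_lin scaleN1r addNr. Qed.

Lemma kernel_op_sum k (I : Type) (r : seq I) (f : I -> V) :
  kernel_op k (\sum_(i <- r) f i) = \sum_(i <- r) kernel_op k (f i).
Proof.
apply: (big_morph (kernel_op k)) => [v v'|]; last exact: kernel_op0.
by rewrite -[v]scale1r kernel_op_lin !scale1r.
Qed.

Lemma kernel_opZ k c v : kernel_op k (c *: v) = c *: kernel_op k v.
Proof. by rewrite -[c *: v]addr0 kernel_op_lin kernel_op0 addr0. Qed.

Lemma kernel_op_state k s w : kernel_op k (state_vec s w) = eval_vec (k s) w.
Proof.
rewrite /kernel_op (bigD1 s) //= ffunE eqxx big1 ?addr0 // => t /negPf ts.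
by rewrite ffunE ts eval_vec0.
Qed.

Lemma kernel_op_add f g v : kernel_op (kadd f g) v = kernel_op f v + kernel_op g v.
Proof. by rewrite /kernel_op -big_split; apply: eq_bigr => s _; exact: eval_vec_cat. Qed.

Lemma kernel_op_sign c f v : kernel_op (ksign c f) v = (-1) ^+ c *: kernel_op f v.
Proof.
rewrite /kernel_op scaler_sumr; apply: eq_bigr => s _.
rewrite /eval_vec big_map scaler_sumr; apply: eq_bigr => x _ /=.
by rewrite signr_addb scalerA.
Qed.

Lemma kernel_op_when c f v : kernel_op (kwhen c f) v = if c then kernel_op f v else 0.
Proof.
case: c => //; rewrite /kernel_op big1 // => s _; exact: big_nil.
Qed.

Lemma word_act_cat u u' w : word_act (u ++ u') w = word_act u (word_act u' w).
Proof. exact: foldr_cat. Qed.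

Lemma kernel_op_comp f g v : kernel_op (kcomp f g) v = kernel_op f (kernel_op g v).
Proof.
have -> : kernel_op g v = \sum_s eval_vec (g s) (v s) by [].
rewrite kernel_op_sum; apply: eq_bigr => s _; rewrite /eval_vec kernel_op_sum big_flatten big_map.
apply: eq_bigr => x _.
rewrite kernel_opZ kernel_op_state big_map scaler_sumr; apply: eq_bigr => y _ /=.
by rewrite signr_addb scalerA word_act_cat.
Qed.

Lemma eval_vec_straighten L w : eval_vec (straighten_vec L) w = eval_vec L w.
Proof.
rewrite /eval_vec big_flatten big_map; apply: eq_bigr => [[b [u s]]] _ /=.
rewrite big_map /= /straighten.
have triv : \sum_(y <- [:: (false, u)])
    (-1) ^+ (b (+) y.1) *: state_vec s (word_act y.2 w)
  = (-1) ^+ b *: state_vec s (word_act u w) by rewrite big_seq1 addbF.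
(* Only an out-of-order pair of even units is rewritten. *)
case: u triv => [|p [|q [|? ?]]] // triv; case: ifP => // /and3P[pE qE _].
rewrite big_cons big_cat /= !(fun_if (fun r => \sum_(y <- r) _)) !big_seq1 !big_nil /=.
rewrite (unit_act_bracket w pE qE) state_vecB state_vecD addbF addbT signrN scaleNr.
rewrite scalerBr scalerDr addrA; congr (_ + _ + _).
- by case: ifP => _; rewrite ?state_vec0 ?scaler0.
- by case: ifP => _; rewrite ?state_vec0 ?scaler0 ?oppr0.
Qed.

Lemma eval_vec_cancelling L w : cancelling L -> eval_vec L w = 0.
Proof.
move=> /allP cancelL.
rewrite /eval_vec (big_signed_count (fun k => state_vec k.2 (word_act k.1 w))
  (undup_uniq (unzip2 L))); last by move=> k; rewrite mem_undup.
rewrite big_seq big1 // => k; rewrite mem_undup => /mapP[x xL ->].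
by rewrite (eqP (cancelL x xL)) subrr.
Qed.

Lemma kernel_op_bracket p q v : p \in gl_units -> q \in gl_units ->
  kernel_op (kernel_bracket p q) v = 0.
Proof.
move=> pI qI; rewrite /kernel_op big1 // => s _; rewrite -eval_vec_straighten.
apply: eval_vec_cancelling; have /allP/(_ p pI)/allP/(_ q qI)/allP := kernel_bracket_check.
by apply; apply: mem_fock_states.
Qed.

End FockModule.

(** * Modules over the enveloping algebra and maps out of an induced module *)

Section FreeExtension.
Variables (K : choiceType) (G V : zmodType) (f : K -> G -> V).
Hypothesis fD : forall k, {morph f k : x y / x + y}.

Definition malg_lift (g : {malg G[K]}) : V := \sum_(k <- msupp g) f k g@_k.

Let f0 k : f k 0 = 0.
Proof. by apply: (addrI (f k 0)); rewrite -fD !addr0. Qed.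

Lemma malg_liftEw (d : {fset K}) g : (msupp g `<=` d)%fset ->
  malg_lift g = \sum_(k <- d) f k g@_k.
Proof.
move=> le_gd; rewrite /malg_lift; apply: big_fset_incl => // k _ /mcoeff_outdom ->.
exact: f0.
Qed.

Lemma malg_liftD : {morph malg_lift : g h / g + h}.
Proof.
move=> g h; rewrite (@malg_liftEw (msupp g `|` msupp h)%fset); last exact: msuppD_le.
rewrite (@malg_liftEw _ g (fsubsetUl _ (msupp h))).
rewrite (@malg_liftEw _ h (fsubsetUr (msupp g) _)) -big_split.
by apply: eq_bigr => k _; rewrite mcoeffD fD.
Qed.

Lemma malg_lift0 : malg_lift 0 = 0.
Proof. by apply: (addrI (malg_lift 0)); rewrite -malg_liftD !addr0. Qed.

Lemma malg_liftB : {morph malg_lift : g h / g - h}.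
Proof.
by move=> g h; apply: (addIr (malg_lift h)); rewrite -malg_liftD !subrK.
Qed.

Lemma malg_lift_sum (I : Type) (r : seq I) (g : I -> {malg G[K]}) :
  malg_lift (\sum_(i <- r) g i) = \sum_(i <- r) malg_lift (g i).
Proof. exact: (big_morph _ malg_liftD malg_lift0). Qed.

Lemma malg_liftU k x : malg_lift << x *g k >> = f k x.
Proof.
rewrite (malg_liftEw (d := [fset k]%fset)) ?msuppU_le //.
by rewrite big_seq_fset1 mcoeffUU.
Qed.

End FreeExtension.

Lemma malg_additive_ind (K : choiceType) (G : zmodType) (P : {malg G[K]} -> Prop) :
    P 0 -> (forall g h, P g -> P h -> P (g + h)) ->
    (forall x k, P << x *g k >>) ->
  forall g, P g.
Proof.
move=> P0 PD PU g; rewrite [g]monalgE; elim: (enum_fset _) => [|k s IHs].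
  by rewrite big_nil.
by rewrite big_cons; apply: PD.
Qed.

Lemma malgU_lin (K : choiceType) (R : nzRingType) (k : K) (c x y : R) :
  << c * x + y *g k >> = c *: << x *g k >> + << y *g k >>.
Proof.
by apply/malgP => m; rewrite mcoeffD mcoeffZ !mcoeffU mulrnAr mulrnDl.
Qed.

Lemma malgZU (K : choiceType) (R : nzRingType) (k : K) (c x : R) :
  c *: << x *g k >> = << c * x *g k >>.
Proof. by rewrite -[c * x]addr0 malgU_lin monalgU0 addr0. Qed.

Lemma quot_proj_rel (A : nzRingType) (V : lmodType A) (S : V -> Prop) x y :
  S (x - y) -> quot_proj S x = quot_proj S y.
Proof.
by move=> Sxy; apply/quot_projP; rewrite -[x - y]scale1r; exact: Submod_genZ.
Qed.

Lemma quot_proj0 (A : nzRingType) (V : lmodType A) (S : V -> Prop) :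
  quot_proj S 0 = 0.
Proof. by apply: (addrI (quot_proj S 0)); rewrite -quot_projD !addr0. Qed.

Lemma malgC_central (K : monomType) (R : fieldType) (c : R) (g : {malg R[K]}) :
  g * c%:MP = c%:MP * g.
Proof.
rewrite malgM_def [RHS]malgM_def fgmulgU fgmulUg; apply: eq_bigr => m _.
by rewrite mulrC mulm1 mul1m.
Qed.

(** Operators on V indexed by the matrix units and satisfying the bracket relations
    make V a U(g)-module. *)
Section UgModule.
Variable F : fieldType.
Notation gl := 'M[F]_4.
Notation Tg := {malg F[{fmonom idx}]}.
Variables (V : lmodType F) (op : idx -> V -> V).
Hypothesis op_lin : forall i c v w, op i (c *: v + w) = c *: op i v + op i w.

Let opD i : {morph op i : v w / v + w}.
Proof. by move=> v w; rewrite -[v]scale1r op_lin !scale1r. Qed.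

Let op0 i : op i 0 = 0.
Proof. by apply: (addrI (op i 0)); rewrite -opD !addr0. Qed.

Let opZ i c v : op i (c *: v) = c *: op i v.
Proof. by rewrite -[c *: v]addr0 op_lin op0 addr0. Qed.

Definition word_op (m : {fmonom idx}) (v : V) : V := foldr op v m.

Lemma word_op_lin m c v w :
  word_op m (c *: v + w) = c *: word_op m v + word_op m w.
Proof. by rewrite /word_op; elim: (m : seq _) => //= i s ->. Qed.

Definition Tg_op (t : Tg) (v : V) : V := malg_lift (fun m c => c *: word_op m v) t.

Let scal_wordD v m : {morph (fun c : F => c *: word_op m v) : x y / x + y}.
Proof. by move=> x y; rewrite scalerDl. Qed.

Lemma Tg_opU c m v : Tg_op << c *g m >> v = c *: word_op m v.
Proof. exact: (malg_liftU (scal_wordD v)). Qed.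

Lemma word_opZ m c v : word_op m (c *: v) = c *: word_op m v.
Proof. by rewrite /word_op; elim: (m : seq _) => //= i s ->. Qed.

Lemma Tg_opD s t v : Tg_op (s + t) v = Tg_op s v + Tg_op t v.
Proof. exact: (malg_liftD (scal_wordD v)). Qed.

Lemma Tg_opB s t v : Tg_op (s - t) v = Tg_op s v - Tg_op t v.
Proof. exact: (malg_liftB (scal_wordD v)). Qed.

Lemma Tg_op0l v : Tg_op 0 v = 0.
Proof. exact: (malg_lift0 (scal_wordD v)). Qed.

Lemma Tg_op_lin t c v w : Tg_op t (c *: v + w) = c *: Tg_op t v + Tg_op t w.
Proof.
rewrite scaler_sumr -big_split; apply: eq_bigr => m _ /=.
by rewrite word_op_lin scalerDr !scalerA mulrC.
Qed.

Lemma Tg_op0 t : Tg_op t 0 = 0.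
Proof. by rewrite -[0 in LHS](addNr 0) -scaleN1r Tg_op_lin scaleN1r addNr. Qed.

Lemma Tg_opDr t v w : Tg_op t (v + w) = Tg_op t v + Tg_op t w.
Proof. by rewrite -[v]scale1r Tg_op_lin !scale1r. Qed.

Lemma Tg_opM s t v : Tg_op (s * t) v = Tg_op s (Tg_op t v).
Proof.
rewrite (malgM_def s t).
elim/malg_additive_ind: s => [|s s' IHs IHs'|c m]; first by rewrite fgmul0g !Tg_op0l.
  by rewrite fgmulgDl (Tg_opD (fgmul s t)) (Tg_opD s); congr (_ + _).
elim/malg_additive_ind: t => [|t t' IHt IHt'|d m']; first by rewrite fgmulg0 Tg_op0l Tg_op0.
  rewrite fgmulgDr (Tg_opD (fgmul _ t)) (Tg_opD t) Tg_opDr.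
  by congr (_ + _).
rewrite fgmulUU; apply: etrans (Tg_opU _ _ _) _; apply: esym.
apply: etrans (congr1 _ (Tg_opU _ _ _)) _; apply: etrans (Tg_opU _ _ _) _.
rewrite word_opZ scalerA; congr (_ *: _).
rewrite /word_op -foldr_cat; congr (foldr op v _).
by have -> : mmul m m' = FMonom (m ++ m') by exact: fmmulE.
Qed.

Lemma Tg_opZ c t v : Tg_op (c *: t) v = c *: Tg_op t v.
Proof.
rewrite -mul_malgC Tg_opM; apply: etrans (Tg_opU _ _ _) _.
by have -> : mone = FMonom [::] :> {fmonom idx} by exact: fmoneE.
Qed.

Definition gl_op (x : gl) (v : V) : V := \sum_i \sum_j x i j *: op (i, j) v.

Lemma Tg_op_tens_elt x v : Tg_op (tens_elt x) v = gl_op x v.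
Proof.
rewrite /Tg_op /tens_elt (malg_lift_sum (scal_wordD v)).
apply: eq_bigr => i _; rewrite (malg_lift_sum (scal_wordD v)).
apply: eq_bigr => j _; rewrite (malg_liftU (scal_wordD v)).
by rewrite /word_op fmuE.
Qed.

Definition idx_par (p : idx) : bool := par p.1 (+) par p.2.

Hypothesis op_unit_bracket : forall p q v,
  op p (op q v) - (-1) ^+ (idx_par p && idx_par q) *: op q (op p v)
  = (if p.2 == q.1 then op (p.1, q.2) v else 0)
    - (-1) ^+ (idx_par p && idx_par q) *: (if q.2 == p.1 then op (q.1, p.2) v else 0).

Lemma gl_opE x v : gl_op x v = \sum_(p : idx) x p.1 p.2 *: op p v.
Proof.
rewrite /gl_op (pair_bigA _ (fun i j => x i j *: op (i, j) v)).
by apply: eq_bigr => -[].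
Qed.

(** Both sides of the bracket relation are expanded over pairs of units, which
    reduces it for arbitrary matrices to [op_unit_bracket]. *)
Lemma gl_op_mulmx x y v : gl_op (x *m y) v =
  \sum_(p : idx) \sum_(q : idx) (x p.1 p.2 * y q.1 q.2) *:
    (if p.2 == q.1 then op (p.1, q.2) v else 0).
Proof.
rewrite -(pair_bigA _ (fun i j => \sum_(q : idx) (x i j * y q.1 q.2) *:
    (if j == q.1 then op (i, q.2) v else 0))).
apply: eq_bigr => i _.
transitivity (\sum_l \sum_j (x i j * y j l) *: op (i, l) v).
  by apply: eq_bigr => l _; rewrite mxE scaler_suml.
rewrite exchange_big; apply: eq_bigr => j _ /=.
rewrite -(pair_bigA _ (fun k l => (x i j * y k l) *:
    (if j == k then op (i, l) v else 0))) /=.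
rewrite [RHS](bigD1 j) //= eqxx [X in _ + X]big1 ?addr0 // => k kj.
by rewrite big1 // => l _; rewrite eq_sym (negPf kj) scaler0.
Qed.

Lemma gl_op_sub x c y v : gl_op (x - c *: y) v = gl_op x v - c *: gl_op y v.
Proof.
rewrite !gl_opE scaler_sumr -sumrB; apply: eq_bigr => p _.
by rewrite !mxE scalerBl scalerA.
Qed.

Lemma gl_op_comp x y v : gl_op x (gl_op y v) =
  \sum_(p : idx) \sum_(q : idx) (x p.1 p.2 * y q.1 q.2) *: op p (op q v).
Proof.
rewrite gl_opE; apply: eq_bigr => p _; rewrite gl_opE.
rewrite (big_morph (op p) (@opD p) (@op0 p)) scaler_sumr.
by apply: eq_bigr => q _; rewrite opZ scalerA.
Qed.

Lemma homog_neq0 d (x : gl) (p : idx) : x \in homog F d -> x p.1 p.2 != 0 ->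
  idx_par p = d.
Proof.
move=> /span_unitsP xd xp; apply/eqP; apply: contraNT xp => pd.
by apply/eqP/xd.
Qed.

Lemma op_bracket d e x y : x \in homog F d -> y \in homog F e ->
  forall v, gl_op (sbracket d e x y) v
            = gl_op x (gl_op y v) - (-1) ^+ (d && e) *: gl_op y (gl_op x v).
Proof.
move=> dx ey v; rewrite gl_op_sub !gl_op_mulmx !gl_op_comp.
rewrite [in LHS]exchange_big [in RHS]exchange_big /=.
rewrite !scaler_sumr -!sumrB; apply: eq_bigr => q _.
rewrite !scaler_sumr -!sumrB; apply: eq_bigr => p _.
have [xp|xp] := eqVneq (x p.1 p.2) 0; first by rewrite xp mulr0 !mul0r !scale0r.
have [yq|yq] := eqVneq (y q.1 q.2) 0; first by rewrite yq mulr0 !mul0r !scale0r.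
rewrite -(homog_neq0 dx xp) -(homog_neq0 ey yq) [y _ _ * _]mulrC.
by rewrite !scalerA ![_ * (x _ _ * _)]mulrC -!scalerA -!scalerBr op_unit_bracket.
Qed.

Lemma Tg_op_rel t : Ug_rel t -> forall v, Tg_op t v = 0.
Proof.
case=> d e x y dx ey v.
rewrite -(subrr (gl_op (sbracket d e x y) v)) {1}op_bracket //.
apply: etrans (Tg_opB _ _ _) _; congr (_ - _); last exact: Tg_op_tens_elt.
apply: etrans (Tg_opB _ _ _) _; congr (_ - _).
  by apply: etrans (Tg_opM _ _ _) _; rewrite !Tg_op_tens_elt.
apply: etrans (Tg_opZ _ _ _) _; congr (_ *: _).
by apply: etrans (Tg_opM _ _ _) _; rewrite !Tg_op_tens_elt.
Qed.

Lemma Tg_op_ideal t : ideal_gen (@Ug_rel F) t -> forall v, Tg_op t v = 0.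
Proof.
elim=> [|s t' _ IHs _ IHt|a s b Ss] v; first exact: Tg_op0l.
  by apply: etrans (Tg_opD _ _ _) _; rewrite IHs IHt addr0.
apply: etrans (Tg_opM _ _ _) _; apply: etrans (Tg_opM _ _ _) _.
apply: etrans (congr1 _ (Tg_op_rel Ss _)) _; exact: Tg_op0.
Qed.

Definition Ug_op (u : Ug F) (v : V) : V := Tg_op (repr u) v.

Lemma Ug_op_proj t v : Ug_op (Ug_proj t) v = Tg_op t v.
Proof.
apply/eqP; rewrite -subr_eq0 -Tg_opB; apply/eqP/Tg_op_ideal.
by apply/Ug_projP; rewrite Ug_projK.
Qed.

Lemma Ug_opD a b v : Ug_op (a + b) v = Ug_op a v + Ug_op b v.
Proof.
rewrite -[a]Ug_projK -[b]Ug_projK -Ug_projD !Ug_op_proj; exact: Tg_opD.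
Qed.

Lemma Ug_opM a b v : Ug_op (a * b) v = Ug_op a (Ug_op b v).
Proof.
rewrite -[a]Ug_projK -[b]Ug_projK -Ug_projM !Ug_op_proj; exact: Tg_opM.
Qed.

Lemma Ug_op_lin a c v w : Ug_op a (c *: v + w) = c *: Ug_op a v + Ug_op a w.
Proof. exact: Tg_op_lin. Qed.

Lemma Ug_op_of x v : Ug_op (Ug_of x) v = gl_op x v.
Proof. by rewrite Ug_op_proj Tg_op_tens_elt. Qed.

Lemma Ug_op_scal c v : Ug_op c%:A v = c *: v.
Proof.
have -> : c%:A = Ug_proj c%:MP :> Ug F by exact: mulr1.
rewrite Ug_op_proj; apply: etrans (Tg_opU _ _ _) _.
by have -> : mone = FMonom [::] :> {fmonom idx} by exact: fmoneE.
Qed.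

(** The universal property of the induced module, in the only form needed below: a
    map of p-modules from W to V extends to the induced module, so what dies
    there already dies in V. *)
Section IndHom.
Variables (W : lmodType F) (p : {vspace gl}) (act : gl -> W -> W).
Variable iota : W -> V.
Hypothesis iota_lin : forall c w w', iota (c *: w + w') = c *: iota w + iota w'.
Hypothesis iota_act : forall x w, x \in p -> iota (act x w) = gl_op x (iota w).

Definition free_hom (f : {malg (Ug F)[W]}) : V :=
  malg_lift (fun w u => Ug_op u (iota w)) f.

Let Ug_op_iotaD w : {morph (fun u => Ug_op u (iota w)) : a b / a + b}.
Proof. by move=> a b; exact: Ug_opD. Qed.

Lemma free_homU u w : free_hom << u *g w >> = Ug_op u (iota w).
Proof. exact: (malg_liftU Ug_op_iotaD). Qed.

Lemma free_homZ a f : free_hom (a *: f) = Ug_op a (free_hom f).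
Proof.
elim/malg_additive_ind: f => [|f g IHf IHg|u w].
- rewrite scaler0 /free_hom (malg_lift0 Ug_op_iotaD).
  by rewrite -[0 in RHS](addNr 0) -scaleN1r Ug_op_lin scaleN1r addNr.
- rewrite scalerDr /free_hom !(malg_liftD Ug_op_iotaD).
  rewrite -[malg_lift _ f]scale1r Ug_op_lin !scale1r.
  by congr (_ + _); [exact: IHf | exact: IHg].
by rewrite malgZU !free_homU Ug_opM.
Qed.

Lemma free_hom_rel f : ind_rel p act f -> free_hom f = 0.
Proof.
case=> [w w'|c w|x w px].
- rewrite /free_hom !(malg_liftB Ug_op_iotaD) !(malg_liftU Ug_op_iotaD).
  have -> : iota (w + w') = iota w + iota w'.
    by rewrite -[w]scale1r iota_lin !scale1r.
  by rewrite -[iota w]scale1r Ug_op_lin !scale1r addrAC addrK subrr.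
- rewrite /free_hom (malg_liftB Ug_op_iotaD) !(malg_liftU Ug_op_iotaD).
  have iota0 : iota 0 = 0.
    by rewrite -[0 in LHS](addNr 0) -scaleN1r iota_lin scaleN1r addNr.
  rewrite -[c *: w]addr0 iota_lin iota0 addr0 -Ug_op_scal -Ug_opM mul1r.
  exact: subrr.
- rewrite /free_hom (malg_liftB Ug_op_iotaD) !(malg_liftU Ug_op_iotaD).
  rewrite iota_act // -Ug_op_of -Ug_opM mul1r; exact: subrr.
Qed.

Lemma free_hom_submod f : submod_gen (ind_rel p act) f -> free_hom f = 0.
Proof.
elim=> [|f1 f2 _ IH1 _ IH2|a g Sg]; first exact: (malg_lift0 Ug_op_iotaD).
  apply: etrans (malg_liftD Ug_op_iotaD _ _) _.
  by rewrite -/(free_hom f1) -/(free_hom f2) IH1 IH2 addr0.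
rewrite free_homZ (free_hom_rel Sg).
by rewrite -[0 in LHS](addNr 0) -scaleN1r Ug_op_lin scaleN1r addNr.
Qed.

Lemma tens1_eq0 w : tens p act 1 w = 0 -> iota w = 0.
Proof.
move=> w0; have Ug_op1 : Ug_op 1 (iota w) = iota w.
  by rewrite -[RHS]scale1r -Ug_op_scal scale1r.
rewrite -Ug_op1 -free_homU; apply: free_hom_submod.
rewrite -[<< _ >>]subr0; apply/quot_projP.
exact: etrans w0 (esym (quot_proj0 _)).
Qed.

End IndHom.

End UgModule.

Section KacNonzero.
Variables (F : fieldType) (W : lmodType F) (act : 'M[F]_4 -> W -> W).
Hypothesis hrep : is_rep act (g0 F).
Notation V := {ffun fock_state -> W}.

Definition fock_op (p : idx) : V -> V := kernel_op act (gl_kernel p.1 p.2).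

Lemma mem_gl_units (i j : 'I_4) : ((i : nat), (j : nat)) \in gl_units.
Proof.
by apply/allpairsP; exists (nat_of_ord i, nat_of_ord j); rewrite !mem_iota !ltn_ord.
Qed.

Lemma fock_op_bracket p q v :
  fock_op p (fock_op q v) - (-1) ^+ (idx_par p && idx_par q) *: fock_op q (fock_op p v)
  = (if p.2 == q.1 then fock_op (p.1, q.2) v else 0)
    - (-1) ^+ (idx_par p && idx_par q) *:
        (if q.2 == p.1 then fock_op (q.1, p.2) v else 0).
Proof.
have := kernel_op_bracket hrep v (mem_gl_units p.1 p.2) (mem_gl_units q.1 q.2).
rewrite /kernel_bracket !(kernel_op_add, kernel_op_sign, kernel_op_when, kernel_op_comp) //=.
rewrite -[unit_par _ && _]/(idx_par p && idx_par q) signrN expr1 scaleN1r !val_eqE => K0.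
apply/eqP; rewrite -subr_eq0 -[X in _ == X]K0 opprB; apply/eqP.
rewrite scaleNr [_ - (if _ then _ else _)]addrC; congr (_ + (_ + _)).
  by case: ifP; rewrite ?oppr0.
by case: ifP; rewrite ?scaler0.
Qed.

(** The empty monomial; W sits in the tensor product as the states over it. *)
Definition vacuum : fock_state := (false, false, false, false).

Lemma fock_vacuum x w : x \in (g0 F + g1 F)%VS ->
  state_vec vacuum (infl act x w) = gl_op fock_op x (state_vec vacuum w).
Proof.
move=> /memv_addP[y /span_unitsP y0 [z /span_unitsP z0 ->]].
have evP : even_part (y + z) \in g0 F.
  by apply/span_unitsP => i j; rewrite mxE; case: (par i); case: (par j).
have state_vecZ c u : state_vec vacuum (c *: u) = c *: state_vec vacuum u :> V.
  by rewrite -[c *: u]addr0 state_vec_lin state_vec0 addr0.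
rewrite /infl (act_units hrep _ evP) (big_morph _ (@state_vecD _ _ vacuum) (state_vec0 _ _)).
apply: eq_bigr => i _; rewrite (big_morph _ (@state_vecD _ _ vacuum) (state_vec0 _ _)).
apply: eq_bigr => j _; rewrite state_vecZ /fock_op kernel_op_state //.
rewrite !mxE.
move: (y0 i j) (z0 i j); rewrite /par.
case: i => [[|[|[|[|//]]]] ip]; case: j => [[|[|[|[|//]]]] jp] /= yij zij;
  rewrite /eval_vec ?big_seq1 ?big_nil /= ?expr0 ?scale1r ?scaler0 ?scale0r //.
all: by rewrite yij // zij // addr0 scale0r.
Qed.

(** W embeds in the Kac module: it embeds in the exterior algebra tensored with
    W, by a map of modules over g_0 + g_1. *)
Lemma kac_tens1_neq0 w : w != 0 -> kac_tens act 1 w != 0.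
Proof.
apply: contraNneq => w0.
have op_lin p c v v' : fock_op p (c *: v + v') = c *: fock_op p v + fock_op p v'.
  exact: kernel_op_lin.
have := @tens1_eq0 F V fock_op op_lin fock_op_bracket W (g0 F + g1 F)%VS (infl act)
  (state_vec vacuum) (@state_vec_lin _ _ vacuum) fock_vacuum w w0.
by move/ffunP/(_ vacuum); rewrite !ffunE eqxx => ->.
Qed.
End KacNonzero.

(** * Casimir elements of the even part *)

Section EvenPart.
Variables (F : numFieldType) (W : lmodType F) (act : 'M[F]_4 -> W -> W).
Hypothesis hrep : is_rep act (g0 F).
Notation e i j := (unit_act act (i%N, j%N)).

Lemma weight_unit (mu : 'rV[F]_4) w (i : 'I_4) :
  has_weight act mu w -> e (val i) (val i) w = mu 0 i *: w.
Proof.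
move=> mu_w; have ii : even_unit (val i, val i).
  by rewrite /even_unit /= ltn_ord /unit_par /= addbb.
have := mu_w (delta_mx 0 i).
rewrite /unit_act ii /gl_unit /= !inord_val (bigD1 i) //= mxE !eqxx mulr1.
rewrite big1 ?addr0 => [<-|j /negPf ji]; last by rewrite mxE ji andbF mulr0.
by rewrite diag_delta.
Qed.

Lemma act_bracket x y w : x \in g0 F -> y \in g0 F ->
  act (x *m y - y *m x) w = act x (act y w) - act y (act x w).
Proof.
move=> xg yg; case: hrep => _ _ br.
by have := br false false x y xg yg xg yg w; rewrite /sbracket expr0 !scale1r.
Qed.

Lemma unit_act0 p : unit_act act p 0 = 0.
Proof. by rewrite -[0 in LHS](addNr 0) -scaleN1r unit_act_lin // scaleN1r addNr. Qed.

Lemma unit_actD p u w : unit_act act p (u + w) = unit_act act p u + unit_act act p w.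
Proof. by rewrite -[u]scale1r unit_act_lin // !scale1r. Qed.

Lemma unit_actN p u : unit_act act p (- u) = - unit_act act p u.
Proof. by apply: (addrI (unit_act act p u)); rewrite -unit_actD !subrr unit_act0. Qed.

Lemma unit_actZ p c u : unit_act act p (c *: u) = c *: unit_act act p u.
Proof. by rewrite -[c *: u]addr0 unit_act_lin // unit_act0 addr0. Qed.

(** The quadratic Casimir element of one of the two blocks gl(2), the block of
    parity s. *)
Definition casimir (s : bool) (u : W) : W :=
  \sum_(m < 4 | par m == s) \sum_(n < 4 | par n == s)
    e (val m) (val n) (e (val n) (val m) u).

Lemma even_unit_ord (k l : 'I_4) : par k == par l -> even_unit (val k, val l).
Proof.
rewrite /even_unit /unit_par !ltn_ord /= => /eqP; rewrite /par /nat_par => ->.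
by rewrite addbb.
Qed.

(** The commutator of E_kl with each summand has four terms A, B, C, D; summed
    over the block, A cancels D and C cancels B because both pairs become the
    same single sum. *)
Lemma casimir_unit s (k l : 'I_4) u : par k == par l ->
  e (val k) (val l) (casimir s u) = casimir s (e (val k) (val l) u).
Proof.
move=> kl; have klE := even_unit_ord kl.
have esum := big_morph (e (val k) (val l)) (@unit_actD (val k, val l)) (unit_act0 _).
have pick (P : pred 'I_4) (f : 'I_4 -> W) (i : 'I_4) :
    \sum_(m < 4 | P m) (if i == m then f m else 0) = if P i then f i else 0.
  rewrite big_mkcond (bigD1 i) //= eqxx big1 ?addr0 // => m /negPf mi.
  by rewrite eq_sym mi if_same.
have br (m n : 'I_4) w : par m == par n ->
    e (val k) (val l) (e (val m) (val n) w) = e (val m) (val n) (e (val k) (val l) w)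
      + (if l == m then e (val k) (val n) w else 0)
      - (if k == n then e (val m) (val l) w else 0).
  move=> mn; rewrite (unit_act_bracket hrep _ klE (even_unit_ord mn)) /=.
  by rewrite !val_eqE [n == k]eq_sym.
pose A (m n : 'I_4) := if l == m then e (val k) (val n) (e (val n) (val m) u) else 0.
pose B (m n : 'I_4) := if k == n then e (val m) (val l) (e (val n) (val m) u) else 0.
pose C (m n : 'I_4) := if l == n then e (val m) (val n) (e (val k) (val m) u) else 0.
pose D (m n : 'I_4) := if k == m then e (val m) (val n) (e (val n) (val l) u) else 0.
have term (m n : 'I_4) : par m == s -> par n == s ->
    e (val k) (val l) (e (val m) (val n) (e (val n) (val m) u))
    = e (val m) (val n) (e (val n) (val m) (e (val k) (val l) u))
      + ((A m n - D m n) + (C m n - B m n)).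
  move=> /eqP ms /eqP ns; rewrite !br ?ms ?ns // unit_actD unit_actD unit_actN.
  rewrite -!addrA; congr (_ + _); rewrite /A /B /C /D.
  have -> : e (val m) (val n) (if l == n then e (val k) (val m) u else 0)
     = if l == n then e (val m) (val n) (e (val k) (val m) u) else 0.
    by case: ifP; rewrite ?unit_act0.
  have -> : e (val m) (val n) (if k == m then e (val n) (val l) u else 0)
     = if k == m then e (val m) (val n) (e (val n) (val l) u) else 0.
    by case: ifP; rewrite ?unit_act0.
  by rewrite addrCA [RHS]addrCA; congr (_ + _); exact: addrCA.
transitivity (casimir s (e (val k) (val l) u)
    + \sum_(m < 4 | par m == s) \sum_(n < 4 | par n == s)
        ((A m n - D m n) + (C m n - B m n))).
  rewrite /casimir esum -big_split; apply: eq_bigr => m ms.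
  by rewrite esum -big_split; apply: eq_bigr => n ns; exact: term.
under eq_bigr => m _ do rewrite big_split /= !sumrB.
have sl : (par l == s) = (par k == s) by rewrite (eqP kl).
rewrite big_split /= !sumrB -[RHS]addr0; congr (_ + _).
(* A and D collapse along the first index, B and C along the second. *)
rewrite [X in X - _ + _]exchange_big [X in _ - X + _]exchange_big /=.
rewrite -sumrB -sumrB -big_split big1 // => m ms; rewrite !pick sl.
by rewrite /= !subrr addr0.
Qed.

Lemma casimir_lin s c u w :
  casimir s (c *: u + w) = c *: casimir s u + casimir s w.
Proof.
rewrite /casimir scaler_sumr -big_split; apply: eq_bigr => m _ /=.
rewrite scaler_sumr -big_split; apply: eq_bigr => n _ /=.
by rewrite !unit_act_lin.
Qed.

(** Schur's lemma in the presence of an eigenvector: the eigenspace is a non-zero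
    submodule. *)
Lemma irreducible_scalar (T : W -> W) kappa w0 :
    irreducible act (g0 F) ->
    (forall c u w, T (c *: u + w) = c *: T u + T w) ->
    (forall x u, x \in g0 F -> act x (T u) = T (act x u)) ->
    w0 != 0 -> T w0 = kappa *: w0 ->
  forall w, T w = kappa *: w.
Proof.
move=> [_ irr] T_lin T_act w0n Tw0.
pose M := [set w | T w = kappa *: w]%classic.
have [||E w] := irr M.
- split.
  + have T0 : T 0 = 0 by rewrite -[0 in LHS](addNr 0) -scaleN1r T_lin scaleN1r addNr.
    by rewrite /M /= T0 scaler0.
  + by move=> c u w; rewrite /M /= T_lin => -> ->; rewrite scalerDr !scalerA mulrC.
  + move=> x w xg; rewrite /M /= => Mw; rewrite -T_act // Mw.
    case: hrep => act_lin _ _; have := act_lin x xg kappa w 0.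
    have := act_lin x xg (-1) 0 0; rewrite scaler0 addr0 scaleN1r addNr => ->.
    by rewrite !addr0.
- by move=> E; have : M w0 by []; rewrite E => /= w00; rewrite w00 eqxx in w0n.
- by have : M w by rewrite E.
Qed.

Lemma casimir_act s x u : x \in g0 F -> act x (casimir s u) = casimir s (act x u).
Proof.
move=> xg; rewrite !(act_units hrep _ xg).
have casimirD v w : casimir s (v + w) = casimir s v + casimir s w.
  by rewrite -[v]scale1r casimir_lin !scale1r.
have casimir0 : casimir s 0 = 0.
  by rewrite -[0 in LHS](addNr 0) -scaleN1r casimir_lin scaleN1r addNr.
have csum := big_morph (casimir s) casimirD casimir0.
rewrite csum; apply: eq_bigr => k _; rewrite csum; apply: eq_bigr => l _.
have [kl|kl] := boolP (par k == par l).
  by rewrite -[x k l *: e _ _ u]addr0 casimir_lin casimir0 addr0 casimir_unit.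
have klN : even_unit (val k, val l) = false.
  by apply: contraNF kl => /and3P[_ _]; rewrite /unit_par negb_add.
by rewrite /unit_act klN !scaler0 casimir0.
Qed.

Lemma casimir_even u : casimir false u =
  e 0 0 (e 0 0 u) + e 0 1 (e 1 0 u) + (e 1 0 (e 0 1 u) + e 1 1 (e 1 1 u)).
Proof.
rewrite /casimir big_mkcond !big_ord_recl big_ord0 /= !addr0.
by do 2!rewrite [\sum_(n < 4 | _) _]big_mkcond !big_ord_recl big_ord0 /= !addr0.
Qed.

Lemma casimir_odd u : casimir true u =
  e 2 2 (e 2 2 u) + e 2 3 (e 3 2 u) + (e 3 2 (e 2 3 u) + e 3 3 (e 3 3 u)).
Proof.
rewrite /casimir big_mkcond !big_ord_recl big_ord0 /= !addr0 !add0r.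
by do 2!rewrite [\sum_(n < 4 | _) _]big_mkcond !big_ord_recl big_ord0 /= !addr0 !add0r.
Qed.

Lemma highest_unit w : (forall x, x \in n0 F -> act x w = 0) ->
  e 0 1 w = 0 /\ e 2 3 w = 0.
Proof.
move=> n0w; split; rewrite /unit_act /=; apply: n0w; apply: delta_span_units;
  by rewrite /par /= !inordK.
Qed.

Lemma half_scalar (X w : W) (k l : F) : l + l = k -> X + X = k *: w -> X = l *: w.
Proof.
move=> lk XX; have two : (2%:R : F) != 0 by rewrite pnatr_eq0.
apply: (scalerI two); rewrite scalerA !scaler_nat mulr2n XX -lk.
by rewrite mulr_natl mulr2n.
Qed.

Section MiddleWeight.
Hypothesis hirr : irreducible act (g0 F).
Variables (a b : F) (w0 v : W).
Hypothesis ab : b = a - 1.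
Hypotheses (w0n : w0 != 0) (w0wt : has_weight act (wt a (- b) b (- a)) w0).
Hypothesis w0top : forall x, x \in n0 F -> act x w0 = 0.
Hypothesis vwt : has_weight act (wt 1 0 (-1) 0) v.

Let wtE x1 x2 x3 x4 w : has_weight act (wt x1 x2 x3 x4) w ->
  [/\ e 0 0 w = x1 *: w, e 1 1 w = x2 *: w, e 2 2 w = x3 *: w & e 3 3 w = x4 *: w].
Proof.
move=> wwt; split.
- by rewrite (weight_unit (@Ordinal 4 0 isT) wwt) mxE.
- by rewrite (weight_unit (@Ordinal 4 1 isT) wwt) mxE.
- by rewrite (weight_unit (@Ordinal 4 2 isT) wwt) mxE.
- by rewrite (weight_unit (@Ordinal 4 3 isT) wwt) mxE.
Qed.

(** The Casimir element acts by a^2 + b^2 + a + b at the highest weight (a, -b),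
    and at v, of weight (1, 0), it is 2 E_12 E_21; half the scalar is a^2 when
    b = a - 1. *)
Lemma raise_lower_even : e 0 1 (e 1 0 v) = a ^+ 2 *: v.
Proof.
have [e00 e11 _ _] := wtE w0wt; have [f00 f11 _ _] := wtE vwt.
have [e01 _] := highest_unit w0top.
have C0 : casimir false w0 = (a ^+ 2 + b ^+ 2 + a + b) *: w0.
  rewrite casimir_even e00 e11 e01 !unit_actZ e00 e11 unit_act0.
  rewrite (unit_act_bracket hrep) //= e01 unit_act0 e00 e11 !(add0r, addr0).
  by rewrite !scalerA -!scaleNr -!scalerDl; congr (_ *: _); ring.
have := irreducible_scalar hirr (casimir_lin false) (casimir_act false) w0n C0 v.
rewrite casimir_even f00 f11 !unit_actZ f00 f11.
rewrite [e 1 0 (e 0 1 v)](unit_act_bracket hrep) //= f00 f11 => Cv.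
apply: (half_scalar (k := a ^+ 2 + b ^+ 2 + a + b)); first by rewrite ab; ring.
by rewrite -Cv !scale0r !scale1r !addr0 [v + _]addrC addrACA subrr addr0.
Qed.

(** The same scalar appears in the other block, of highest weight (b, -a), with v of
    weight (-1, 0); this coincidence makes the final difference vanish. *)
Lemma lower_raise_odd : e 3 2 (e 2 3 v) = a ^+ 2 *: v.
Proof.
have [_ _ e00 e11] := wtE w0wt; have [_ _ f00 f11] := wtE vwt.
have [_ e01] := highest_unit w0top.
have C0 : casimir true w0 = (a ^+ 2 + b ^+ 2 + a + b) *: w0.
  rewrite casimir_odd e00 e11 e01 !unit_actZ e00 e11 unit_act0.
  rewrite (unit_act_bracket hrep) //= e01 unit_act0 e00 e11 !(add0r, addr0).
  by rewrite !scalerA -!scaleNr -!scalerDl; congr (_ *: _); ring.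
have := irreducible_scalar hirr (casimir_lin true) (casimir_act true) w0n C0 v.
rewrite casimir_odd f00 f11 !unit_actZ f00 f11.
rewrite [e 2 3 (e 3 2 v)](unit_act_bracket hrep) //= f00 f11 => Cv.
apply: (half_scalar (k := a ^+ 2 + b ^+ 2 + a + b)); first by rewrite ab; ring.
by rewrite -Cv !scale0r !scaleN1r opprK subr0 addr0 addrCA subrr addr0.
Qed.
End MiddleWeight.

End EvenPart.

(** * The three degrees of gl(2|2) *)

Section Degrees.
Variable F : fieldType.

Definition gm1 := span_units F (fun i j => par i && ~~ par j).

(** E_11 + E_22. *)
Definition grading_elt : 'M[F]_4 := diag_mx (\row_i (~~ par i)%:R).

Lemma gm1_odd x : x \in gm1 -> x \in homog F true.
Proof. by apply: span_units_homog => i j; case: (par i); case: (par j). Qed.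

Lemma g1_odd x : x \in g1 F -> x \in homog F true.
Proof. by apply: span_units_homog => i j; case: (par i); case: (par j). Qed.

Lemma grading_elt_g0 : grading_elt \in g0 F.
Proof.
apply/span_unitsP => i j; rewrite !mxE; case: (i =P j) => [->|//].
by rewrite addbb.
Qed.

Lemma grading_bracket_g0 x : x \in g0 F -> grading_elt *m x - x *m grading_elt = 0.
Proof.
move=> /span_unitsP x0; rewrite mul_diag_mx mul_mx_diag; apply/matrixP => i j.
rewrite !mxE; have [ij|/x0->] := boolP (par i (+) par j == false).
  by move: ij; case: (par i); case: (par j) => // _; rewrite mulrC subrr.
by rewrite mul0r mulr0 subrr.
Qed.

Lemma grading_bracket_gm1 x : x \in gm1 -> grading_elt *m x - x *m grading_elt = - x.
Proof.
move=> /span_unitsP x0; rewrite mul_diag_mx mul_mx_diag; apply/matrixP => i j.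
rewrite !mxE; have [|/x0->] := boolP (par i && ~~ par j).
  by case: (par i); case: (par j) => // _; rewrite mul0r mulr1 sub0r.
by rewrite mul0r mulr0 subrr oppr0.
Qed.

Ltac by_parity := move=> ? ? ?; do 3!case: (par _).

Lemma bracket_g0_gm1 x y : x \in g0 F -> y \in gm1 -> x *m y - y *m x \in gm1.
Proof.
move=> xg yg; apply: memvB.
  by apply: span_units_mulmx xg yg; by_parity.
by apply: span_units_mulmx yg xg; by_parity.
Qed.

Lemma bracket_g0_g1 x y : x \in g0 F -> y \in g1 F -> x *m y - y *m x \in g1 F.
Proof.
move=> xg yg; apply: memvB.
  by apply: span_units_mulmx xg yg; by_parity.
by apply: span_units_mulmx yg xg; by_parity.
Qed.

Lemma bracket_g1_gm1 x y : x \in g1 F -> y \in gm1 -> x *m y + y *m x \in g0 F.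
Proof.
move=> xg yg; apply: memvD.
  by apply: span_units_mulmx xg yg; by_parity.
by apply: span_units_mulmx yg xg; by_parity.
Qed.

Lemma mulmx_g1 x y : x \in g1 F -> y \in g1 F -> x *m y = 0.
Proof.
move=> /span_unitsP x0 /span_unitsP y0; apply/matrixP => i j; rewrite !mxE.
rewrite big1 // => k _; have [k1|k0] := boolP (par k).
  by rewrite y0 ?mulr0 // k1.
by rewrite x0 ?mul0r // negb_and k0 orbT.
Qed.

Notation E i k := (gl_unit F (i%N, k%N)).

Lemma gl_unitM i k l m : (k < 4)%N -> (l < 4)%N ->
  E i k *m E l m = if k == l then E i m else 0.
Proof.
move=> k4 l4; rewrite mul_delta_mx_cond -val_eqE /= !inordK //.
by case: eqP.
Qed.

Lemma g1_units x : x \in g1 F ->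
  x = x (inord 0) (inord 2) *: E 0 2 + x (inord 0) (inord 3) *: E 0 3
    + x (inord 1) (inord 2) *: E 1 2 + x (inord 1) (inord 3) *: E 1 3.
Proof.
move=> /span_unitsP x0; apply/matrixP => i k; rewrite !mxE -!val_eqE /= !inordK //.
have xE p q (pp : (p < 4)%N) (qp : (q < 4)%N) :
    x (Ordinal pp) (Ordinal qp) = x (inord p) (inord q).
  by congr (x _ _); apply: val_inj; rewrite /= inordK.
move: (x0 i k); rewrite /par.
case: i => [[|[|[|[|//]]]] ip]; case: k => [[|[|[|[|//]]]] kp] /= xik;
  move: xik; rewrite xE ?mulr1 ?mulr0 ?addr0 ?add0r // => -> //.
Qed.

End Degrees.

(** * Submodules of a Kac module *)

(** What the arguments about submodules use of U = U(g), of the map e from g to U, of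
    the Kac module K and of the map j from W to K: the bracket relations, that g
    generates U, that W generates K, how g_0 and g_1 act on W, and that W
    embeds. *)
Record kac_spec (F : numFieldType) (W : lmodType F) (act : 'M[F]_4 -> W -> W)
    (U : lalgType F) (e : 'M[F]_4 -> U) (K : lmodType U) (j : W -> K) : Prop :=
  KacSpec {
    kac_e_lin : forall c x y, e (c *: x + y) = c *: e x + e y;
    kac_e_bracket : forall d d' x y, x \in homog F d -> y \in homog F d' ->
      e (sbracket d d' x y) = e x * e y - (-1) ^+ (d && d') *: (e y * e x);
    kac_central : forall c (u : U), u * c%:A = c%:A * u;
    kac_U_ind : forall P : U -> Prop,
      (forall c, P c%:A) -> (forall a b, P a -> P b -> P (a + b)) ->
      (forall a i k, P a -> P (a * e (delta_mx i k))) -> forall a, P a;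
    kac_j_lin : forall c w w', j (c *: w + w') = c%:A *: j w + j w';
    kac_j_g0 : forall x w, x \in g0 F -> e x *: j w = j (act x w);
    kac_j_g1 : forall x w, x \in g1 F -> e x *: j w = 0;
    kac_K_ind : forall P : K -> Prop,
      (forall u v, P u -> P v -> P (u + v)) -> (forall a w, P (a *: j w)) ->
      forall u, P u;
    kac_j_neq0 : forall w, w != 0 -> j w != 0
  }.

Section KacStructure.
Variables (F : numFieldType) (W : lmodType F) (act : 'M[F]_4 -> W -> W).
Hypothesis hrep : is_rep act (g0 F).
Hypothesis hirr : irreducible act (g0 F).
Variables (U : lalgType F) (e : 'M[F]_4 -> U) (K : lmodType U) (j : W -> K).
Hypothesis kacP : kac_spec act e j.

Let e_lin := kac_e_lin kacP.
Let e_bracket := kac_e_bracket kacP.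
Let U_central := kac_central kacP.
Let U_ind := kac_U_ind kacP.
Let j_lin := kac_j_lin kacP.
Let j_g0 := kac_j_g0 kacP.
Let j_g1 := kac_j_g1 kacP.
Let K_ind := kac_K_ind kacP.
Let j_neq0 := kac_j_neq0 kacP.

Let eD x y : e (x + y) = e x + e y.
Proof. by rewrite -[x]scale1r e_lin !scale1r. Qed.

Let e0 : e 0 = 0.
Proof. by apply: (addrI (e 0)); rewrite -eD !addr0. Qed.

Let eZ c x : e (c *: x) = c *: e x.
Proof. by rewrite -[c *: x]addr0 e_lin e0 addr0. Qed.

Let eN x : e (- x) = - e x.
Proof. by rewrite -scaleN1r eZ scaleN1r. Qed.

Let scalA c (a : U) (u : K) : (c *: a) *: u = c%:A *: (a *: u).
Proof. by rewrite scalerA -scalerAl mul1r. Qed.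

Let scal_comm c (a : U) (u : K) : a *: (c%:A *: u) = c%:A *: (a *: u).
Proof. by rewrite !scalerA U_central. Qed.

Let scalAA c d (u : K) : c%:A *: (d%:A *: u) = (c * d)%:A *: u.
Proof. by rewrite -scalA scalerA. Qed.

Let scalAD c d (u : K) : c%:A *: u + d%:A *: u = (c + d)%:A *: u.
Proof. by rewrite -scalerDl -scalerDl. Qed.

Let scal_one (u : K) : (1%:A : U) *: u = u.
Proof. by rewrite scale1r scale1r. Qed.

Let j0 : j 0 = 0.
Proof.
have := j_lin (-1) 0 0; rewrite scaler0 addr0 scaleN1r scaleNr scale1r.
by move=> ->; rewrite addNr.
Qed.

Let jZ c w : j (c *: w) = c%:A *: j w.
Proof. by rewrite -[c *: w]addr0 j_lin j0 addr0. Qed.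

Let jD w w' : j (w + w') = j w + j w'.
Proof. by rewrite -[w]scale1r j_lin scal_one scale1r. Qed.

Lemma comm_even d x y (u : K) : x \in g0 F -> y \in homog F d ->
  e x *: (e y *: u) = e y *: (e x *: u) + e (x *m y - y *m x) *: u.
Proof.
move=> xg yd; have := e_bracket xg yd; rewrite /sbracket /= expr0 !scale1r => ->.
by rewrite !scalerA -scalerDl addrC subrK.
Qed.

Lemma comm_odd x y (u : K) : x \in homog F true -> y \in homog F true ->
  e x *: (e y *: u) = e (x *m y + y *m x) *: u - e y *: (e x *: u).
Proof.
move=> xg yd; have := e_bracket xg yd; rewrite /sbracket /= expr1 !scaleN1r !opprK => ->.
by rewrite !scalerA -scalerBl addrK.
Qed.

Lemma comm_g1_gm1 x y (u : K) : x \in g1 F -> y \in gm1 F ->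
  e x *: (e y *: u) = e (x *m y + y *m x) *: u - e y *: (e x *: u).
Proof. by move=> xg yg; apply: comm_odd; [exact: g1_odd | exact: gm1_odd]. Qed.

(** The n-th piece of K, spanned by products of n elements of g_-1 applied to W. *)
Inductive grade : nat -> K -> Prop :=
| grade_top w : grade 0 (j w)
| grade_lower n x u of x \in gm1 F & grade n u : grade n.+1 (e x *: u)
| gradeD n u v of grade n u & grade n v : grade n (u + v).

Lemma grade0 n : grade n 0.
Proof.
elim: n => [|n IHn]; first by rewrite -j0; exact: grade_top.
by rewrite -(scaler0 _ (e 0)); apply: grade_lower => //; exact: mem0v.
Qed.

Lemma grade_scal c n u : grade n u -> grade n (c%:A *: u).
Proof.
elim=> {n u} [w|n x u xg _ IHu|n u v _ IHu _ IHv].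
- by rewrite -jZ; exact: grade_top.
- by rewrite -scal_comm; exact: grade_lower.
- by rewrite scalerDr; exact: gradeD.
Qed.

Lemma gradeN n u : grade n u -> grade n (- u).
Proof. by move=> /(grade_scal (-1)); rewrite scaleN1r scaleNr scale1r. Qed.

Lemma grade_g0 x n u : x \in g0 F -> grade n u -> grade n (e x *: u).
Proof.
move=> xg; elim=> {n u} [w|n y u yg gu IHu|n u v _ IHu _ IHv].
- by rewrite j_g0 //; exact: grade_top.
- rewrite (comm_even _ xg (gm1_odd yg)); apply: gradeD; first exact: grade_lower.
  by apply: grade_lower => //; exact: bracket_g0_gm1.
- by rewrite scalerDr; exact: gradeD.
Qed.

Lemma grade_g1 x n u : x \in g1 F -> grade n u ->
  if n is m.+1 then grade m (e x *: u) else e x *: u = 0.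
Proof.
move=> xg; elim=> {n u} [w|n y u yg gu IHu|n u v _ IHu _ IHv].
- exact: j_g1.
- rewrite (comm_g1_gm1 _ xg yg); apply: gradeD.
    by apply: grade_g0 => //; exact: bracket_g1_gm1.
  apply: gradeN; case: n gu IHu => [_ ->|n _ gu]; last exact: grade_lower.
  by rewrite scaler0; exact: grade0.
- rewrite scalerDr; case: n IHu IHv => [-> ->|n gu gv]; [exact: addr0|exact: gradeD].
Qed.

Section Weights.
Variable c : F.
Hypothesis grading_top : forall w, act (grading_elt F) w = c *: w.

Lemma grade_eigen n u : grade n u -> e (grading_elt F) *: u = (c - n%:R)%:A *: u.
Proof.
elim=> {n u} [w|n x u xg _ IHu|n u v _ IHu _ IHv].
- by rewrite j_g0 ?grading_elt_g0 // grading_top jZ subr0.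
- rewrite (comm_even _ (grading_elt_g0 F) (gm1_odd xg)) IHu scal_comm grading_bracket_gm1 //.
  rewrite eN scaleNr -[X in _ - X]scal_one -scaleNr -scaleNr scalAD.
  by rewrite -natr1 opprD addrA.
- by rewrite !scalerDr IHu IHv.
Qed.

(** The product of the z - (c - m) for 1 <= m <= N, where z is the grading element.
    It kills the pieces 1, ..., N and acts on W by N!, so it extracts the top
    component of a vector. *)
Fixpoint kill_low (N : nat) : U :=
  if N is N'.+1 then (e (grading_elt F) - (c - N%:R)%:A) * kill_low N' else 1.

Lemma kill_low_grade N n u : grade n u ->
  kill_low N *: u = (\prod_(k < N) (k.+1%:R - n%:R))%:A *: u.
Proof.
move=> gu; elim: N => [|N IHN] /=; first by rewrite big_ord0 scal_one scale1r.
rewrite -scalerA IHN scal_comm big_ord_recr /= scalerBl (grade_eigen gu).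
rewrite -scaleNr -scaleNr scalAD scalAA; congr (_%:A *: _); ring.
Qed.

(** The sum of the pieces of degree at least 1. *)
Inductive low : K -> Prop :=
| low0 : low 0
| lowD u v of low u & low v : low (u + v)
| low_grade n u of grade n.+1 u : low u.

Lemma low_scal a u : low u -> low (a%:A *: u).
Proof.
elim=> {u} [|u v _ IHu _ IHv|n u gu].
- by rewrite scaler0; exact: low0.
- by rewrite scalerDr; exact: lowD.
- by apply: (low_grade (n := n)); exact: grade_scal.
Qed.

Lemma kill_low_low u : low u -> exists N0, forall N, (N0 <= N)%N -> kill_low N *: u = 0.
Proof.
elim=> {u} [|u v _ [N1 IHu] _ [N2 IHv]|n u gu].
- by exists 0%N => N _; rewrite scaler0.
- exists (maxn N1 N2) => N; rewrite geq_max => /andP[le1 le2].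
  by rewrite scalerDr IHu // IHv // addr0.
- (* The factor m = n + 1 of the eigenvalue vanishes. *)
  exists n.+1 => N le_nN; rewrite (kill_low_grade _ gu) (bigD1 (Ordinal le_nN)) //=.
  by rewrite subrr mul0r !scale0r.
Qed.

Lemma kill_low_top N w : kill_low N *: j w = j (N`!%:R *: w).
Proof.
rewrite (kill_low_grade _ (grade_top w)) -jZ; congr (j (_ *: _)).
under eq_bigr => k _ do rewrite subr0.
by rewrite -natr_prod fact_prod big_add1 big_mkord.
Qed.

(** The top meets the lower pieces trivially: the operator above separates their
    eigenvalues, and W embeds in K. *)
Lemma low_top w : low (j w) -> w = 0.
Proof.
move=> /kill_low_low[N /(_ N (leqnn N))]; rewrite kill_low_top => jw0.
apply/eqP; apply: contraPT jw0 => wn; apply/eqP/j_neq0.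
by rewrite scaler_eq0 negb_or wn pnatr_eq0 -lt0n fact_gt0.
Qed.

Definition top_low (u : K) := exists w v, u = j w + v /\ low v.

Lemma top_lowD u v : top_low u -> top_low v -> top_low (u + v).
Proof.
move=> [w [u' [-> lu]]] [w' [v' [-> lv]]]; exists (w + w'), (u' + v').
by rewrite jD addrACA; split=> //; exact: lowD.
Qed.

Lemma grade_top_low n u : grade n u -> top_low u.
Proof.
case: n => [|n] gu; last first.
  by exists 0, u; rewrite j0 add0r; split=> //; exact: (low_grade gu).
suff [w ->] : exists w, u = j w.
  by exists w, 0; rewrite addr0; split=> //; exact: low0.
move: gu; move En: 0%N => n gu.
elim: gu En => {n u} [w|//|n u v _ IHu _ IHv] En; first by exists w.
by have [w ->] := IHu En; have [w' ->] := IHv En; exists (w + w'); rewrite jD.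
Qed.

Lemma delta_degree i k : [\/ (delta_mx i k : 'M[F]_4) \in gm1 F,
  (delta_mx i k : 'M[F]_4) \in g0 F | (delta_mx i k : 'M[F]_4) \in g1 F].
Proof.
case Pi: (par i); case Pk: (par k);
  [constructor 2 | constructor 1 | constructor 3 | constructor 2];
  by apply: delta_span_units; rewrite Pi Pk.
Qed.

(** K is spanned by the pieces, since each is sent to a neighbour by every matrix
    unit; g_1 maps degree 0 to 0, so nothing leaves at the top. *)
Lemma kac_top_low u : top_low u.
Proof.
apply: K_ind u => [u v|a w]; first exact: top_lowD.
suff P b : forall n u, grade n u -> top_low (b *: u) by exact: P (grade_top w).
apply: (U_ind (P := fun b => forall n u, grade n u -> top_low (b *: u))) b.
- by move=> d n u gu; apply: grade_top_low (grade_scal d gu).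
- move=> b b' Pb Pb' n u gu; rewrite scalerDl.
  by apply: top_lowD; [exact: Pb gu | exact: Pb' gu].
move=> b i k Pb n u gu; rewrite -scalerA; case: (delta_degree i k) => dg.
- by apply: Pb (grade_lower dg gu).
- by apply: Pb (grade_g0 dg gu).
- have := grade_g1 dg gu; case: n gu => [|n] gu; last exact: Pb.
  by move=> ->; rewrite scaler0; exact: grade_top_low (grade0 0).
Qed.

Definition submod_closed (N : K -> Prop) :=
  N 0 /\ forall (a : U) u v, N u -> N v -> N (a *: u + v).

Lemma submod_full N w : submod_closed N -> w != 0 -> N (j w) -> forall u, N u.
Proof.
move=> [N0 Nlin] wn Nw.
have NZ a u : N u -> N (a *: u) by move=> Nu; rewrite -[_ *: _]addr0; exact: Nlin.
have Nj w' : N (j w').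
  have [||E] := (hirr.2 [set w' | N (j w')])%classic.
  - split=> [|d w1 w2 N1 N2|x w1 xg N1] /=.
    + by rewrite j0.
    + by rewrite j_lin; apply: Nlin.
    + by rewrite -j_g0 //; apply: NZ.
  - move=> E; have : ([set w' | N (j w')]%classic) w by [].
    by rewrite E => /= w0; rewrite w0 eqxx in wn.
  - have : ([set w' | N (j w')]%classic) w' by rewrite E.
    by [].
apply: K_ind => [u v Nu Nv|a w']; last exact: NZ.
by rewrite -[u]scale1r; exact: Nlin.
Qed.

(** The radical of K: the largest submodule without top component. *)
Definition kac_rad (u : K) := forall a : U, low (a *: u).

Lemma kac_rad_submod : submod_closed kac_rad.
Proof.
split=> [a|a u v Ru Rv b]; first by rewrite scaler0; exact: low0.
by rewrite scalerDr scalerA; apply: lowD.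
Qed.

Lemma kac_rad_top w : kac_rad (j w) -> w = 0.
Proof. by move=> /(_ 1); rewrite scale1r; exact: low_top. Qed.

(** A vector of N outside the radical has a multiple j w + (lower terms) with
    w <> 0, and [kill_low] turns it into a non-zero multiple of j w. *)
Lemma submod_rad_or_full N : submod_closed N ->
  (forall u, N u -> kac_rad u) \/ (forall u, N u).
Proof.
move=> Nsub; have [NR|] := pselect (forall u, N u -> kac_rad u); first by left.
move=> /existsNP[u /not_implyP[Nu /existsNP[a nlow]]]; right.
have [N0 Nlin] := Nsub.
have NZ b x : N x -> N (b *: x) by move=> Nx; rewrite -[_ *: _]addr0; exact: Nlin.
have [w [v [auE lv]]] := kac_top_low (a *: u).
have wn : w != 0.
  by apply: contra_notN nlow => /eqP w0; rewrite auE w0 j0 add0r.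
have [M /(_ M (leqnn M)) Dv] := kill_low_low lv.
apply: (@submod_full N (M`!%:R *: w)) => //.
  by rewrite scaler_eq0 negb_or wn pnatr_eq0 -lt0n fact_gt0.
rewrite -kill_low_top -[X in N X]addr0 -Dv -scalerDr -auE; exact/NZ/NZ.
Qed.

(** Vectors of degree n killed by every product of n elements of g_1.  For n = 0
    this forces u = 0, so that singular vectors have no top component. *)
Fixpoint singular (n : nat) (u : K) : Prop :=
  if n is m.+1 then grade n u /\ forall x, x \in g1 F -> singular m (e x *: u)
  else u = 0.

Lemma singular0 n : singular n 0.
Proof.
elim: n => //= n IHn; split=> [|x _]; first exact: grade0.
by rewrite scaler0.
Qed.

Lemma singularD n u v : singular n u -> singular n v -> singular n (u + v).
Proof.
elim: n u v => [u v -> ->|n IHn u v [gu su] [gv sv]]; first by rewrite /= addr0.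
split=> [|x xg]; first exact: gradeD.
by rewrite scalerDr; apply: IHn; [exact: su | exact: sv].
Qed.

Lemma singular_scal a n u : singular n u -> singular n (a%:A *: u).
Proof.
elim: n u => [u ->|n IHn u [gu su]]; first by rewrite /= scaler0.
split=> [|x xg]; first exact: grade_scal.
by rewrite scal_comm; apply/IHn/su.
Qed.

Lemma singularN n u : singular n u -> singular n (- u).
Proof. by move=> /(singular_scal (-1)); rewrite scaleN1r scaleNr scale1r. Qed.

Lemma singular_g0 x n u : x \in g0 F -> singular n u -> singular n (e x *: u).
Proof.
move=> xg; elim: n u => [u ->|n IHn u [gu su]]; first by rewrite /= scaler0.
split=> [|y yg]; first exact: grade_g0.
have -> : e y *: (e x *: u) = e x *: (e y *: u) - e (x *m y - y *m x) *: u.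
  by rewrite (comm_even _ xg (g1_odd yg)) addrK.
apply: singularD; first exact/IHn/su.
exact/singularN/su/bracket_g0_g1.
Qed.

(** For y in g_1, y x u = [y, x] u - x y u, where [y, x] is in g_0 and y u is
    singular of degree one less. *)
Lemma singular_gm1 x n u : x \in gm1 F -> singular n u -> singular n.+1 (e x *: u).
Proof.
move=> xg; elim: n u => [u ->|n IHn u su]; first by rewrite scaler0; exact: singular0.
have [gu su'] := su; split=> [|y yg]; first exact: grade_lower.
rewrite (comm_g1_gm1 _ yg xg); apply: singularD.
  by apply: singular_g0 su; exact: bracket_g1_gm1.
exact/singularN/IHn/su'.
Qed.

(** Each matrix unit sends singular vectors to singular vectors of a neighbouring
    degree, so the submodule they generate never reaches the top. *)
Lemma singular_rad n u : singular n u -> kac_rad u.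
Proof.
move=> su a; move: a n u su.
apply: U_ind => [d [|n] u su|a b Pa Pb n u su|a i k Pa n u su].
- by rewrite su scaler0; exact: low0.
- by apply: low_scal; case: su => gu _; exact: low_grade gu.
- by rewrite scalerDl; apply: lowD; [exact: Pa su | exact: Pb su].
rewrite -scalerA; case: (delta_degree i k) => dg.
- exact: Pa (singular_gm1 dg su).
- exact: Pa (singular_g0 dg su).
- case: n su => [->|n [_ su]]; first by rewrite scaler0; exact: (Pa 0%N).
  exact: Pa (su _ dg).
Qed.

End Weights.

(** * The vector E_31 (x) v and the subalgebra k *)

(** Indices are shifted by one with respect to the names of the lemmas: E 0 2 is
    the unit E_13. *)
Notation E i k := (gl_unit F (i%N, k%N)).
Notation ua i k := (unit_act act (i%N, k%N)).

Lemma g1_anticomm x y (u : K) : x \in g1 F -> y \in g1 F ->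
  e x *: (e y *: u) = - (e y *: (e x *: u)).
Proof.
move=> xg yg; rewrite (comm_odd _ (g1_odd xg) (g1_odd yg)).
by rewrite !mulmx_g1 // addr0 e0 scale0r sub0r.
Qed.

Lemma self_opp0 (u : K) : u = - u -> u = 0.
Proof.
move=> uN; have two : (2%:R : F) != 0 by rewrite pnatr_eq0.
rewrite -[u]scal_one -(mulVf two) -scalAA.
have -> : 2%:R%:A *: u = u + u by rewrite scaler_nat mulr2n scalerDl !scale1r.
by rewrite {1}uN addNr scaler0.
Qed.

Lemma g1_square x (u : K) : x \in g1 F -> e x *: (e x *: u) = 0.
Proof. by move=> xg; apply: self_opp0; exact: g1_anticomm. Qed.

Lemma unit_g1 i k : (i < 2)%N -> (2 <= k < 4)%N -> E i k \in g1 F.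
Proof.
move=> i2 /andP[k2 k4]; apply: delta_span_units.
by rewrite /par /= !inordK // ?(ltn_trans i2) // k2 -ltnNge i2.
Qed.

Lemma unit_gm1 i k : (i < 2)%N -> (2 <= k < 4)%N -> E k i \in gm1 F.
Proof.
move=> i2 /andP[k2 k4]; apply: delta_span_units.
by rewrite /par /= !inordK // ?(ltn_trans i2) // k2 -ltnNge i2.
Qed.

Lemma g1_kill (u : K) :
    e (E 0 2) *: u = 0 -> e (E 0 3) *: u = 0 -> e (E 1 2) *: u = 0 ->
    e (E 1 3) *: u = 0 ->
  forall x, x \in g1 F -> e x *: u = 0.
Proof.
move=> u02 u03 u12 u13 x xg; rewrite (g1_units xg) !eD !eZ !scalerDl.
by rewrite !(scalA _ (e _)) u02 u03 u12 u13 !scaler0 !addr0.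
Qed.

Lemma xi11_gm1 : xi11 F \in gm1 F.
Proof. exact: (@unit_gm1 0 2). Qed.

(** All that matters about W is the weight of v and that E_12 E_21 and E_43 E_34
    act on v by the same scalar s. *)
Section MiddleVector.
Variables (s : F) (v : W).
Hypothesis vwt : has_weight act (wt 1 0 (-1) 0) v.
Hypothesis v01 : ua 0 1 (ua 1 0 v) = s *: v.
Hypothesis v32 : ua 3 2 (ua 2 3 v) = s *: v.

Definition omega : K := e (xi11 F) *: j v.

Lemma e_even_unit i k w : even_unit (i, k) -> e (E i k) *: j w = j (ua i k w).
Proof. by move=> ik; rewrite j_g0 ?even_unit_g0 // /unit_act ik. Qed.

Lemma g1_gm1_top x y w : x \in g1 F -> y \in gm1 F ->
  e x *: (e y *: j w) = e (x *m y + y *m x) *: j w.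
Proof.
move=> xg yg; rewrite (comm_g1_gm1 _ xg yg) (j_g1 _ xg).
by rewrite scaler0 subr0.
Qed.

(** omega has weight (1, 0 | -1, 0) + (-1, 0 | 1, 0) = 0. *)
Lemma diag_omega h : e (diag_mx h) *: omega = 0.
Proof.
have hg : diag_mx h \in g0 F.
  apply/span_unitsP => i k; rewrite mxE; case: (i =P k) => [->|//].
  by rewrite addbb.
have xg := xi11_gm1.
rewrite /omega (comm_even _ hg (gm1_odd xg)) j_g0 // vwt.
have -> : diag_mx h *m xi11 F - xi11 F *m diag_mx h
    = (h 0 (inord 2) - h 0 (inord 0)) *: xi11 F.
  rewrite mul_diag_mx mul_mx_diag; apply/matrixP => i k; rewrite !mxE.
  case: (i =P inord 2) => [->|_] /=; last by rewrite mulr0 mul0r mulr0 subrr.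
  case: (k =P inord 0) => [->|_] /=; last by rewrite mulr0 mul0r mulr0 subrr.
  by rewrite !mulr1 mul1r.
rewrite jZ scal_comm eZ (scalA _ (e (xi11 F))) scalAD.
suff -> : \sum_i wt 1 0 (-1) 0 0 i * h 0 i + (h 0 (inord 2) - h 0 (inord 0)) = 0.
  by rewrite !scale0r.
rewrite !big_ord_recl big_ord0 !mxE /=.
have -> : inord 0 = ord0 :> 'I_4 by apply: val_inj; rewrite /= inordK.
have -> : inord 2 = lift ord0 (lift ord0 ord0) :> 'I_4.
  by apply: val_inj; rewrite /= inordK.
by rewrite !mul0r mul1r; ring.
Qed.

(** E_13 E_31 v = (E_11 + E_33) v, and the two weights of v cancel. *)
Lemma omega_E13 : e (E 0 2) *: omega = 0.
Proof.
rewrite /omega g1_gm1_top ?unit_g1 ?xi11_gm1 // -[xi11 F]/(E 2 0).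
rewrite !gl_unitM //= eD scalerDl !e_even_unit // -jD.
have f i := weight_unit i vwt.
have := f (@Ordinal 4 0 isT); have := f (@Ordinal 4 2 isT); rewrite !mxE /= => -> ->.
by rewrite -scalerDl subrr scale0r j0.
Qed.

Lemma omega_E24 : e (E 1 3) *: omega = 0.
Proof.
rewrite /omega g1_gm1_top ?unit_g1 ?xi11_gm1 // -[xi11 F]/(E 2 0).
by rewrite !gl_unitM //= addr0 e0 scale0r.
Qed.

Lemma omega_E23 : e (E 1 2) *: omega = j (ua 1 0 v).
Proof.
rewrite /omega g1_gm1_top ?unit_g1 ?xi11_gm1 // -[xi11 F]/(E 2 0).
by rewrite !gl_unitM //= addr0 e_even_unit.
Qed.

Lemma omega_E14 : e (E 0 3) *: omega = j (ua 2 3 v).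
Proof.
rewrite /omega g1_gm1_top ?unit_g1 ?xi11_gm1 // -[xi11 F]/(E 2 0).
by rewrite !gl_unitM //= add0r e_even_unit.
Qed.

Lemma omega_E31 : e (E 2 0) *: omega = 0.
Proof.
apply: self_opp0; rewrite /omega -[xi11 F]/(E 2 0) {1}comm_odd ?gm1_odd ?unit_gm1 //.
by rewrite !gl_unitM //= addr0 e0 scale0r sub0r.
Qed.

(** The one unit of k that does not kill omega gives a vector of degree 2. *)
Definition omega2 : K := e (E 3 1) *: omega.

Lemma omega2_E13 : e (E 0 2) *: omega2 = 0.
Proof.
rewrite /omega2 comm_g1_gm1 ?unit_g1 ?unit_gm1 //.
by rewrite omega_E13 scaler0 subr0 !gl_unitM //= addr0 e0 scale0r.
Qed.

Lemma omega2_E24 : e (E 1 3) *: omega2 = 0.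
Proof.
rewrite /omega2 comm_g1_gm1 ?unit_g1 ?unit_gm1 //.
rewrite omega_E24 scaler0 subr0 !gl_unitM //=.
by rewrite eD scalerDl /gl_unit -!diag_delta !diag_omega addr0.
Qed.

Lemma omega2_E23 : e (E 1 2) *: omega2 = e (E 3 2) *: omega - e (E 3 1) *: j (ua 1 0 v).
Proof.
rewrite /omega2 comm_g1_gm1 ?unit_g1 ?unit_gm1 //.
by rewrite omega_E23 !gl_unitM //= add0r.
Qed.

(** This is the vector E_43 E_34 v - E_12 E_21 v of the top. *)
Lemma omega2_E14_E23 : e (E 0 3) *: (e (E 1 2) *: omega2) = 0.
Proof.
rewrite omega2_E23 scalerBr (g1_gm1_top (ua 1 0 v)) ?unit_g1 ?unit_gm1 //.
rewrite !gl_unitM //= addr0.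
rewrite e_even_unit // v01.
(* Commuting E_43 past E_14 costs a multiple of E_13, which kills omega. *)
have := @comm_even true (E 3 2) (E 0 3) omega.
rewrite !gl_unitM //= omega_E14 e_even_unit // v32 sub0r eN scaleNr omega_E13 oppr0.
by rewrite addr0 even_unit_g0 // g1_odd ?unit_g1 // => <- //; rewrite subrr.
Qed.

(** Elements of g_1 anticommute, so of the products of two of E_13, E_14, E_23,
    E_24 only those of E_14 and E_23 remain to be checked, the others ending in
    E_13, in E_24 or in a square. *)
Lemma omega2_singular : singular 2 omega2.
Proof.
have g2 : grade 2 omega2.
  by do 2!(apply: grade_lower; first exact: unit_gm1); exact: grade_top.
split=> // x xg; split; first exact: (grade_g1 xg g2).
have U02 := @unit_g1 0 2 isT isT; have U03 := @unit_g1 0 3 isT isT.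
have U12 := @unit_g1 1 2 isT isT; have U13 := @unit_g1 1 3 isT isT.
have E12_E03 : e (E 1 2) *: (e (E 0 3) *: omega2) = 0.
  by rewrite g1_anticomm // omega2_E14_E23 oppr0.
have pass y : y \in g1 F -> e y *: omega2 = 0 ->
    forall z, z \in g1 F -> e y *: (e z *: omega2) = 0.
  by move=> yg y0 z zg; rewrite g1_anticomm // y0 scaler0 oppr0.
have zero03 : forall z, z \in g1 F -> e z *: (e (E 0 3) *: omega2) = 0.
  by apply: g1_kill; rewrite ?(pass _ U02 omega2_E13) ?(pass _ U13 omega2_E24) ?g1_square.
have zero12 : forall z, z \in g1 F -> e z *: (e (E 1 2) *: omega2) = 0.
  apply: g1_kill; rewrite ?(pass _ U02 omega2_E13) ?(pass _ U13 omega2_E24) ?g1_square //.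
  exact: omega2_E14_E23.
apply: g1_kill; [exact: (pass _ U02 omega2_E13)| | |exact: (pass _ U13 omega2_E24)].
  by rewrite g1_anticomm // zero03 // oppr0.
by rewrite g1_anticomm // zero12 // oppr0.
Qed.

Lemma kk_omega_rad x : x \in kk F -> kac_rad (e x *: omega).
Proof.
move=> /span_unitsP x0.
have [R0 Rlin] := kac_rad_submod.
have RD u w : kac_rad u -> kac_rad w -> kac_rad (u + w).
  by move=> Ru Rw; rewrite -[u]scale1r; exact: Rlin.
rewrite (matrix_sum_delta x) (big_morph e eD e0) scaler_suml.
apply: (big_ind kac_rad) => // i _; rewrite (big_morph e eD e0) scaler_suml.
apply: (big_ind kac_rad) => // k _.
have [ik|/x0->] := boolP [|| i == k, (k == i + 2 :> nat)%N | (i == k + 2 :> nat)%N];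
  last by rewrite scale0r e0 scale0r.
rewrite eZ scalA -[_ *: _]addr0; apply: Rlin => //.
have unitE p q : i = p :> nat -> k = q :> nat -> delta_mx i k = E p q.
  by move=> <- <-; rewrite /gl_unit /= !inord_val.
have [<-|nik] := eqVneq i k.
  by rewrite -diag_delta diag_omega.
have : [|| (i == 0 :> nat) && (k == 2 :> nat), (i == 1 :> nat) && (k == 3 :> nat),
    (i == 2 :> nat) && (k == 0 :> nat) | (i == 3 :> nat) && (k == 1 :> nat)]%N.
  move: ik nik; rewrite -!val_eqE.
  by case: i {x0 unitE} => [[|[|[|[|//]]]] ip]; case: k => [[|[|[|[|//]]]] kp].
case/or4P => /andP[/eqP iE /eqP gl_kernel]; rewrite (unitE _ _ iE gl_kernel).
- by rewrite omega_E13.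
- by rewrite omega_E24.
- by rewrite omega_E31.
- exact: singular_rad omega2_singular.
Qed.

Lemma omega_generates : s != 0 -> v != 0 -> forall u, exists a : U, u = a *: omega.
Proof.
move=> sn vn.
apply: (@submod_full (fun u => exists a : U, u = a *: omega) (ua 1 0 v)).
- split; first by exists 0; rewrite scale0r.
  by move=> a u w [b ->] [b' ->]; exists (a * b + b'); rewrite scalerDl scalerA.
- apply: contraNneq vn => v10; move: v01; rewrite v10 unit_act0 // => /esym/eqP.
  by rewrite scaler_eq0 (negPf sn).
- by exists (e (E 1 2)); rewrite omega_E23.
Qed.

End MiddleVector.

End KacStructure.

(** * The enveloping algebra and the Kac module as quotients *)

Section EnvelopingAlgebra.
Variable F : fieldType.
Notation Tg := {malg F[{fmonom idx}]}.

Lemma tens_elt_lin c (x y : 'M[F]_4) :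
  tens_elt (c *: x + y) = c *: tens_elt x + tens_elt y.
Proof.
rewrite /tens_elt scaler_sumr -big_split; apply: eq_bigr => i _.
rewrite scaler_sumr -big_split; apply: eq_bigr => j _ /=.
rewrite !mxE; exact: malgU_lin.
Qed.

Lemma Ug_proj_scale c (t : Tg) : Ug_proj (c *: t) = c *: Ug_proj t.
Proof. by rewrite -mul_malgC Ug_projM. Qed.

Lemma Ug_of_lin c (x y : 'M[F]_4) : Ug_of (c *: x + y) = c *: Ug_of x + Ug_of y.
Proof. by rewrite /Ug_of tens_elt_lin Ug_projD Ug_proj_scale. Qed.

Lemma ideal_gen_id (A : nzRingType) (S : A -> Prop) s : S s -> ideal_gen S s.
Proof. by move=> Ss; rewrite -[s]mul1r -[1 * s]mulr1; exact: Ideal_genM. Qed.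

Lemma Ug_proj0 : Ug_proj (0 : Tg) = 0.
Proof. by apply: (addrI (Ug_proj 0)); rewrite -Ug_projD !addr0. Qed.

Lemma Ug_projB (s t : Tg) : Ug_proj (s - t) = Ug_proj s - Ug_proj t.
Proof. by apply: (addIr (Ug_proj t)); rewrite -Ug_projD !subrK. Qed.

Lemma Ug_proj_bracket c (p q r : Tg) :
  Ug_proj (p * q - c *: (q * p) - r)
  = Ug_proj p * Ug_proj q - c *: (Ug_proj q * Ug_proj p) - Ug_proj r.
Proof.
have pqE := Ug_projM p q.
have qpE := congr1 (fun a : Ug F => c *: a) (Ug_projM q p).
have {}qpE := etrans (Ug_proj_scale c (q * p)) qpE.
have {pqE qpE}E := congr2 (fun a b : Ug F => a - b) pqE qpE.
have {}E := etrans (Ug_projB (p * q) (c *: (q * p))) E.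
have {}E := congr1 (fun a : Ug F => a - Ug_proj r) E.
have {}E := etrans (Ug_projB (p * q - c *: (q * p)) r) E.
exact: E.
Qed.

Lemma Ug_of_bracket d d' (x y : 'M[F]_4) : x \in homog F d -> y \in homog F d' ->
  Ug_of (sbracket d d' x y)
  = Ug_of x * Ug_of y - (-1) ^+ (d && d') *: (Ug_of y * Ug_of x).
Proof.
move=> dx dy; apply/esym/eqP; rewrite -subr_eq0; apply/eqP.
apply: etrans (esym (Ug_proj_bracket _ _ _ _)) _; apply: etrans Ug_proj0.
by apply/Ug_projP; rewrite subr0; apply: ideal_gen_id; exact: UgRel.
Qed.

Lemma Ug_scalE c : c%:A = Ug_proj c%:MP :> Ug F.
Proof. exact: mulr1. Qed.

Lemma Ug_scalar_central c (u : Ug F) : u * c%:A = c%:A * u.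
Proof.
rewrite Ug_scalE -[u]Ug_projK; move: (repr u) => t.
have E := congr1 (@Ug_proj F) (malgC_central c t).
have {}E := etrans (esym (Ug_projM t c%:MP)) E.
have {}E := etrans E (Ug_projM c%:MP t).
exact: E.
Qed.

Lemma Ug_of_delta i j : Ug_of (delta_mx i j) = Ug_proj << fmu (i, j) >> :> Ug F.
Proof.
congr Ug_proj; rewrite /tens_elt (bigD1 i) //= (bigD1 j) //= mxE !eqxx.
rewrite !big1 => [|k ki|k kj]; last 2 first.
- by rewrite big1 // => l _; rewrite mxE (negPf ki) monalgU0.
- by rewrite mxE (negPf kj) andbF monalgU0.
by rewrite !addr0.
Qed.

(** Words are peeled off from the right, so that the last generator is the one that
    acts first on a vector. *)
Lemma Ug_gen_ind (P : Ug F -> Prop) :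
    (forall c, P c%:A) -> (forall a b, P a -> P b -> P (a + b)) ->
    (forall a i j, P a -> P (a * Ug_of (delta_mx i j))) ->
  forall a, P a.
Proof.
move=> Pscal PD PM a; rewrite -[a]Ug_projK; move: (repr a) => t {a}.
elim/malg_additive_ind: t => [|s t Ps Pt|c m].
- by rewrite Ug_proj0 -(scale0r 1); exact: Pscal.
- by rewrite Ug_projD; apply: PD.
rewrite -[m]fmK; elim/last_ind: (fmonom_val m) => [|u [i j] IHu].
  have -> : FMonom [::] = mone :> {fmonom idx} by exact: esym (fmoneE _).
  by rewrite -Ug_scalE; exact: Pscal.
suff -> : Ug_proj << c *g FMonom (rcons u (i, j)) >>
    = Ug_proj << c *g FMonom u >> * Ug_of (delta_mx i j) by exact: PM.
rewrite Ug_of_delta; apply: etrans (Ug_projM _ _); congr Ug_proj; apply: esym.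
apply: etrans (fgmulUU _ _ _ _) _; rewrite mulr1 -cats1; congr << _ *g _ >>.
by apply: etrans (fmmulE _ _) _; rewrite fmuE.
Qed.

End EnvelopingAlgebra.

Section KacModule.
Variables (F : fieldType) (W : lmodType F) (act : 'M[F]_4 -> W -> W).
Hypothesis hrep : is_rep act (g0 F).

Lemma kac_tensE (u : Ug F) w : kac_tens act u w = u *: kac_tens act 1 w.
Proof.
apply: etrans (esym (quot_scale_pi _ _ _)).
by congr quot_proj; apply: esym; apply: etrans (malgZU _ _ _) _; rewrite mulr1.
Qed.

Lemma kac_tens_lin c w w' :
  kac_tens act 1 (c *: w + w') = c%:A *: kac_tens act 1 w + kac_tens act 1 w'.
Proof.
pose q := quot_proj (ind_rel (g0 F + g1 F)%VS (infl act)).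
have sumE : q << c *: w + w' >> = q (<< c *: w >> + << w' >>).
  by apply: quot_proj_rel; rewrite opprD addrA; exact: IndRelD.
have scalE : q << c%:A *g w >> = q << c *: w >>.
  by apply: quot_proj_rel; exact: IndRelZ.
have {}sumE := etrans sumE (quot_projD _ _ _).
have {}sumE := etrans sumE (congr1 (fun x => x + q << w' >>) (esym scalE)).
rewrite -kac_tensE; exact: sumE.
Qed.

Lemma kac_tens_par x w : x \in (g0 F + g1 F)%VS ->
  Ug_of x *: kac_tens act 1 w = kac_tens act 1 (infl act x w).
Proof.
by move=> xp; rewrite -kac_tensE; apply: quot_proj_rel; exact: IndRelA.
Qed.

Lemma kac_tens_g0 x w : x \in g0 F ->
  Ug_of x *: kac_tens act 1 w = kac_tens act 1 (act x w).
Proof.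
move=> xg; rewrite kac_tens_par; last by rewrite -[x]addr0 memv_add ?mem0v.
congr (kac_tens act 1 (act _ w)); apply/matrixP => i j; rewrite mxE.
move/span_unitsP: xg => x0; case: eqP => // /eqP ij; rewrite x0 //.
by move: ij; case: (par i); case: (par j).
Qed.

Lemma kac_tens_g1 x w : x \in g1 F -> Ug_of x *: kac_tens act 1 w = 0.
Proof.
move=> xg; rewrite kac_tens_par; last by rewrite -[x]add0r memv_add ?mem0v.
have -> : infl act x w = 0.
  rewrite /infl; have -> : even_part x = 0.
    apply/matrixP => i j; rewrite !mxE; case: eqP => // ij.
    by move/span_unitsP: xg => ->; rewrite // ij; case: (par j).
  rewrite (act_units hrep) ?mem0v // big1 // => i _; rewrite big1 // => j _.
  by rewrite mxE scale0r.
have := kac_tens_lin 1 0 0; rewrite scaler0 addr0 !scale1r => E.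
by apply: (addrI (kac_tens act 1 0)); rewrite addr0; exact: esym E.
Qed.

Lemma kac_gen_ind (P : Kac act -> Prop) :
    (forall u v, P u -> P v -> P (u + v)) ->
    (forall a w, P (a *: kac_tens act 1 w)) ->
  forall u, P u.
Proof.
move=> PD PZ u; rewrite -[u]quot_projK; move: (repr u) => f {u}.
elim/malg_additive_ind: f => [|f g Pf Pg|u w].
- by rewrite quot_proj0 -(scale0r (kac_tens act 1 0)); exact: PZ.
- by rewrite quot_projD; exact: PD.
- by rewrite -[quot_proj _ _]/(kac_tens act u w) kac_tensE; exact: PZ.
Qed.

End KacModule.

(** * Quasi-sphericity *)

Section KacQuasiSpherical.
Variables (F : numFieldType) (W : lmodType F) (act : 'M[F]_4 -> W -> W).
Hypothesis hrep : is_rep act (g0 F).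
Hypothesis hirr : irreducible act (g0 F).

Lemma kac_spec_Kac : kac_spec act (@Ug_of F) (kac_tens act 1).
Proof.
split.
- exact: Ug_of_lin.
- exact: Ug_of_bracket.
- exact: Ug_scalar_central.
- exact: Ug_gen_ind.
- exact: kac_tens_lin.
- exact: kac_tens_g0.
- exact: kac_tens_g1.
- exact: kac_gen_ind.
- exact: kac_tens1_neq0.
Qed.

(** The grading element is central in g_0, so it acts as at the highest weight. *)
Lemma grading_elt_scalar (mu : 'rV[F]_4) : has_highest_weight act mu ->
  exists c, forall w, act (grading_elt F) w = c *: w.
Proof.
move=> [w0 [w0n w0wt _]]; eexists.
apply: (irreducible_scalar hrep hirr _ _ w0n (w0wt _)) => [d u w|x u xg].
  by case: hrep => act_lin _ _; apply: act_lin; exact: grading_elt_g0.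
apply/esym/eqP; rewrite -subr_eq0 -(act_bracket hrep) ?grading_elt_g0 //.
rewrite grading_bracket_g0 // (act_units hrep) ?mem0v // big1 // => i _.
by rewrite big1 // => j _; rewrite mxE scale0r.
Qed.

Lemma kac_quasi_spherical (a b : F) (v : W) :
    b = a - 1 -> a != 0 -> has_highest_weight act (wt a (- b) b (- a)) ->
    v != 0 -> has_weight act (wt 1 0 (-1) 0) v ->
  quasi_spherical (kk F) (kac_tens act (Ug_of (xi11 F)) v).
Proof.
move=> ab an hw vn vwt; have [c zc] := grading_elt_scalar hw.
have [w0 [w0n w0wt w0top]] := hw.
have v01 := raise_lower_even hrep hirr ab w0n w0wt w0top vwt.
have v32 := lower_raise_odd hrep hirr ab w0n w0wt w0top vwt.
have s0 : a ^+ 2 != 0 by rewrite expf_neq0.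
have gen := omega_generates hrep hirr kac_spec_Kac v01 s0 vn.
have rad := kk_omega_rad kac_spec_Kac vwt v01 v32.
pose M : set (Kac act) := kac_rad (@Ug_of F) (kac_tens act 1).
have Msub : is_submod M by exact: kac_rad_submod.
have top w : M (kac_tens act 1 w) -> w = 0 by exact: (kac_rad_top kac_spec_Kac zc).
have dich N : is_submod N -> (N `<=` M)%classic \/ N = setT.
  move=> Nsub; have [NM|NT] := submod_rad_or_full hirr kac_spec_Kac zc Nsub.
    by left.
  by right; apply/seteqP; split.
have MT : M <> setT.
  by move=> E; have : M (kac_tens act 1 v) by [rewrite E]; move/top/eqP; apply/negP.
rewrite kac_tensE; exists M; split.
- split=> [|N [Nsub NT Nmax]].
    split=> // N Nsub MN; have [NM|->] := dich N Nsub; last by right.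
    by left; apply/seteqP.
  by have [NM|//] := dich N Nsub; have [->|//] := Nmax M Msub NM.
- apply/eqP => om0; have [a' E] := gen (kac_tens act 1 v).
  have := kac_tens1_neq0 hrep vn; rewrite E /omega om0 scaler0.
  by rewrite eqxx.
- exact: rad.
- exact: gen.
Qed.

End KacQuasiSpherical.

Theorem theorem4p12 (R : realType) (lam : seq nat) (a b : nat)
    (hlam : H11 lam) (hlamE : lam = a :: nseq b 1%N)
    (ha : (1 <= a)%N) (hb : b = (a - 1)%N)
    (W : lmodType R[i]) (act : 'M[R[i]]_4 -> W -> W)
    (hrep : is_rep act (g0 R[i])) (hirr : irreducible act (g0 R[i]))
    (hhw : has_highest_weight act (wt a%:R (- b%:R) b%:R (- a%:R)))
    (v : W) (hv : v != 0) (hvwt : has_weight act (wt 1 0 (-1) 0) v) :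
  quasi_spherical (kk R[i]) (kac_tens act (Ug_of (xi11 R[i])) v).
Proof.
apply: (kac_quasi_spherical hrep hirr _ _ hhw hv hvwt).
  by rewrite hb natrB.
by rewrite pnatr_eq0 -lt0n.
Qed.
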